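(* Let $A$ be an integral operator on $L^2[0,1]$ with continuous kernel $A:[0,1]^2\to\mathbb{R}$. Suppose that $\mathbf{I}+A$ decomposes as $$\mathbf{I}+A=(\mathbf{I}+T)(\mathbf{I}+T^* ),$$ where $T$ is a triangular integral operator on $L^2[0,1]$. Assume that the kernel $T(x,y)$ is continuous on the closed lower triangle $\{(x,y) : 0\le x\le 1,\ 0\le y\le x\}$ (in general $T$ is not continuous as a function on $[0,1]^2$). Then $$\log\det(\mathbf{I}+A)=\int_0^1 T(t,t)\,\mathrm{d}t .$$
   Context: $L^2[0,1]$ is the real Hilbert space of square-integrable real-valued functions on $[0,1]$, $\mathbf{I}$ is the identity operator, and $^*$ denotes the adjoint. The same symbol is used for an integral operator and its kernel: $Kf(t)=\int_0^1 K(t,s)f(s)\,\mathrm{d}s$ for $f\in L^2[0,1]$. A triangular operator is an integral operator whose kernel satisfies $T(x,y)=0$ for $x<y$. The values $T(t,t)$ are those of the kernel that is continuous on the closed lower triangle. For an integral operator $K$ on $L^2[0,1]$ with continuous kernel, $\det(\mathbf{I}+K)$ denotes the Fredholm determinant $$\det(\mathbf{I}+K):=\sum_{n=0}^\infty \frac{1}{n!}\int_0^1\cdots\int_0^1 \det\big[K(x_p,x_q)\big]_{p,q=1}^n\,\mathrm{d}x_1\cdots\mathrm{d}x_n ,$$ where the $n=0$ term equals $1$. Here $\log$ is the real natural logarithm of a positive real number. *)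

(* Defs.v *)
From HB Require Import structures.
From mathcomp Require Import all_boot all_order all_algebra.
From mathcomp Require Import all_classical all_reals all_analysis.

Set Implicit Arguments.
Unset Strict Implicit.
Unset Printing Implicit Defensive.

Import Order.TTheory GRing.Theory Num.Theory.
Import numFieldNormedType.Exports.

Local Open Scope classical_set_scope.
Local Open Scope ring_scope.

(* Analysis over an arbitrary [R : realType].  A kernel on [0,1]^2 is a
   function [R -> R -> R] of which only the values on [0,1]^2 are used. *)

Definition leb01 (R : realType) :
    {measure set (measurableTypeR R) -> \bar R} :=
  mrestr (@lebesgue_measure R) (measurable_itv `[(0 : R), 1]).

(* The elements are the square-integrable functions themselves, not their
   classes modulo a.e. equality (the quotient [LspaceType2] carries no algebraic
   structure in the library); equality in L^2 is therefore [%[ae leb01 R]]. *)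
Definition L2 (R : realType) := LfunType (leb01 R) (lee1n 2).

Definition L2_dot (R : realType) (f g : L2 R) : R :=
  \int[lebesgue_measure]_(t in `[0, 1]) (f t * g t).

Definition integral_operator (R : realType) (K : R -> R -> R)
    (F : L2 R -> L2 R) : Prop :=
  forall f : L2 R,
    (F f : R -> R)
    = (fun t => \int[lebesgue_measure]_(s in `[0, 1]) (K t s * f s))
    %[ae leb01 R].

(* [G] is the adjoint of [F]; this determines [G] up to a.e. equality. *)
Definition is_adjoint (R : realType) (F G : L2 R -> L2 R) : Prop :=
  forall f g : L2 R, L2_dot (F f) g = L2_dot f (G g).

Definition id_plus (R : realType) (F : L2 R -> L2 R) : L2 R -> L2 R :=
  fun f => f + F f.

Definition L2_op_eq (R : realType) (F G : L2 R -> L2 R) : Prop :=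
  forall f : L2 R, (F f : R -> R) = (G f : R -> R) %[ae leb01 R].

Definition continuous_on_square (R : realType) (K : R -> R -> R) : Prop :=
  {within [set z : R * R | 0 <= z.1 <= 1 /\ 0 <= z.2 <= 1],
    continuous (fun z : R * R => K z.1 z.2)}.

Definition continuous_on_lower_triangle (R : realType) (K : R -> R -> R) :
    Prop :=
  {within [set z : R * R | 0 <= z.1 <= 1 /\ 0 <= z.2 <= z.1],
    continuous (fun z : R * R => K z.1 z.2)}.

Definition triangular_kernel (R : realType) (K : R -> R -> R) : Prop :=
  forall x y : R, 0 <= x <= 1 -> 0 <= y <= 1 -> x < y -> K x y = 0.

(* Iterated integral over [0,1]^n, the first coordinate outermost. *)
Fixpoint iter_integral01 (R : realType) (n : nat) :
    (n.-tuple R -> R) -> R :=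
  match n return (n.-tuple R -> R) -> R with
  | 0 => fun F => F [tuple]
  | m.+1 => fun F =>
      \int[lebesgue_measure]_(x in `[0, 1])
        iter_integral01 (fun v : m.-tuple R => F [tuple of x :: v])
  end.

Definition fredholm_term (R : realType) (K : R -> R -> R) (n : nat) : R :=
  n`!%:R^-1 *
  iter_integral01 (fun x : n.-tuple R =>
    \det (\matrix_(p < n, q < n) K (tnth x p) (tnth x q))).

(* det(I + K); meaningful only when the series converges. *)
Definition fredholm_det (R : realType) (K : R -> R -> R) : R :=
  limn (series (fredholm_term K)).

(* Main.v *)
(** Discretize [0,1] by the grid [i/n].  Comparing continuous kernels in
    [I + A = (I + T)(I + T^* )] gives, with [tau] the symmetric extension of [T]
    from the lower triangle,
      [A(x,y) = tau(x,y) + \int_0^{min(x,y)} tau(x,s) tau(y,s) ds].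
    Let [L] be the lower triangular matrix with entries [T(i/n,j/n)/n] below the
    diagonal and [1 + T(i/n,i/n)/(2n)] on it.  Then [n (L L^T - 1)] is uniformly
    close to [A(i/n,j/n)], while [det (L L^T) = \prod_i (1 + T(i/n,i/n)/(2n))^2]
    tends to [exp (\int T(t,t) dt)].  On the other hand [det (1 + M/n)] is the sum
    of the principal minors of [M/n]; the minors of order [k] sum to a Riemann sum
    of the [k]-th Fredholm term, and Hadamard's inequality bounds them by a
    summable sequence, so [det (L L^T)] tends to the Fredholm determinant. *)

Require Import Defs.
From HB Require Import structures.
From mathcomp Require Import all_boot all_order all_algebra.
From mathcomp Require Import all_classical all_reals all_analysis.
From mathcomp Require Import perm measurable_realfun ring lra.

Set Implicit Arguments.
Unset Strict Implicit.
Unset Printing Implicit Defensive.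

Import Order.TTheory GRing.Theory Num.Theory.
Import numFieldNormedType.Exports.

Local Open Scope classical_set_scope.
Local Open Scope ring_scope.

(** Multiplicativity of Fredholm determinants cannot be applied directly: the kernel of [T] jumps
    across the diagonal, so the terms of a Fredholm series for [T] depend on a choice of diagonal
    values. On the grid this is settled by hand: the factor 1/2 in the diagonal entries of [L] is
    the midpoint of the jump from [T(t,t)] to 0, and the factors [L] and [L^T] together restore the
    full [T(t,t)]. The other obstacle is that the factorization is known only for operators, almost
    everywhere, with the adjoint given by a pairing and not by a kernel. The pointwise identity is
    therefore obtained by pairing with indicators of two short intervals of length [d] and dividing
    by [d * d]. This needs room to the right of [x], hence is done for [x < 1], which covers the
    grid points [i/n] with [i < n]. Convergence of the Fredholm series is not established
    beforehand: the domination argument yields it together with the value, an exponential, so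
    positivity is available before the logarithm is taken. *)

(** * Determinants of finite matrices: principal minors and Hadamard's inequality *)

Lemma det_add1_mulmxC (R : comNzRingType) (m n : nat)
    (A : 'M[R]_(m, n)) (B : 'M[R]_(n, m)) :
  \det (1%:M + A *m B) = \det (1%:M + B *m A).
Proof.
(* Sylvester's identity: both products equal the block matrix with rows [1, A] and [- B, 1]. *)
have E1 : block_mx (1%:M + A *m B) A 0 1%:M *m block_mx 1%:M 0 (- B) 1%:M
    = block_mx 1%:M 0 (- B) 1%:M *m block_mx 1%:M A 0 (1%:M + B *m A).
  rewrite !mulmx_block !mulmx0 !mul0mx !mul1mx !mulmx1 ?addr0 ?add0r.
  by rewrite mulmxN addrK mulNmx addrCA addNr addr0.
have := congr1 determinant E1.
by rewrite !det_mulmx !det_ublock !det_lblock !det1 !mulr1 !mul1r.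
Qed.

(** Multilinearity in the rows, read off the Leibniz formula: [S] records the rows in which the
    summand [A] is chosen. *)
Lemma det_add_rows (R : comNzRingType) (n : nat) (A B : 'M[R]_n) :
  \det (A + B) = \sum_(S : {set 'I_n})
    \det (\matrix_(i, j) (if i \in S then A i j else B i j)).
Proof.
rewrite /determinant exchange_big /=; apply: eq_bigr => s _.
rewrite -big_distrr /=; congr (_ * _).
under eq_bigr do rewrite mxE.
rewrite bigA_distr; apply: eq_bigr => S _.
by apply: eq_bigr => i _; rewrite mxE.
Qed.

(* The left-hand matrix is [1 + P^T (P (M - 1))] for the 0-1 matrix [P] selecting
   the rows listed in [t]. *)
Lemma det_principal_minor (R : comNzRingType) (n k : nat) (M : 'M[R]_n)
    (t : k.-tuple 'I_n) : uniq t ->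
  \det (\matrix_(i, j) (if i \in t then M i j else (i == j)%:R))
  = \det (\matrix_(p < k, q < k) M (tnth t p) (tnth t q)).
Proof.
move=> ut.
pose P : 'M[R]_(k, n) := \matrix_(p, i) (tnth t p == i)%:R.
have PN (N : 'M[R]_n) p j : (P *m N) p j = N (tnth t p) j.
  rewrite mxE (bigD1 (tnth t p)) //= big1 ?addr0 ?mxE ?eqxx ?mul1r // => i ne.
  by rewrite mxE eq_sym (negPf ne) mul0r.
have NP (m : nat) (N : 'M[R]_(m, n)) i q : (N *m P^T) i q = N i (tnth t q).
  rewrite mxE (bigD1 (tnth t q)) //= big1 ?addr0 ?mxE ?eqxx ?mulr1 // => j ne.
  by rewrite !mxE eq_sym (negPf ne) mulr0.
have inj_t : injective (tnth t) by apply/tuple_uniqP.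
rewrite [X in \det X = _](_ : _ = 1%:M + P^T *m (P *m (M - 1%:M))); last first.
  apply/matrixP => i j; rewrite !mxE.
  under eq_bigr do rewrite PN !mxE.
  case: ifPn => [/tnthP[p ->]|nt].
    rewrite (bigD1 p) //= eqxx mul1r big1 ?addr0 => [|q].
      by rewrite addrC subrK.
    by rewrite (inj_eq inj_t) => /negPf ->; rewrite mul0r.
  rewrite big1 ?addr0 // => q _.
  rewrite (_ : (tnth t q == i) = false) ?mul0r //.
  by apply: contraNF nt => /eqP <-; rewrite mem_tnth.
rewrite det_add1_mulmxC; congr (\det _); apply/matrixP => p q.
by rewrite mxE NP PN !mxE (inj_eq inj_t) addrC subrK.
Qed.

(** Ordered tuples with repetition, divided by [k!], instead of subsets: this is the shape of
    [fredholm_term], so that the sum is literally a Riemann sum for it. *)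
Definition minor_sum (R : fieldType) (n : nat) (M : 'M[R]_n) (k : nat) : R :=
  k`!%:R^-1 * \sum_(t : k.-tuple 'I_n)
    \det (\matrix_(p < k, q < k) M (tnth t p) (tnth t q)).

(** A tuple with a repeated index gives two equal rows and contributes 0; each set of [k] indices is
    listed by [k!] injective tuples, which cancels the prefactor. *)
Lemma minor_sumE (R : numFieldType) (n : nat) (M : 'M[R]_n) (k : nat) :
  minor_sum M k = \sum_(S : {set 'I_n} | #|S| == k)
    \det (\matrix_(i, j) (if i \in S then M i j else (i == j)%:R)).
Proof.
rewrite /minor_sum (bigID (fun t : k.-tuple 'I_n => uniq t)) /=.
rewrite [X in _ + X]big1 ?addr0; last first.
  move=> t nut; have /injectivePn[p [q npq tpq]] : ~~ injectiveb (tnth t).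
    by apply: contra nut => /injectiveP it; apply/tuple_uniqP.
  by apply: (determinant_alternate npq) => j; rewrite !mxE tpq.
rewrite (partition_big (fun t : k.-tuple 'I_n => [set i in t])
   (fun S : {set 'I_n} => #|S| == k)) /=; last first.
  by move=> t ut; rewrite cardsE (card_uniqP ut) size_tuple.
rewrite big_distrr /=; apply: eq_bigr => S /eqP cS.
transitivity (k`!%:R^-1 * \sum_(t : k.-tuple 'I_n | uniq t && ([set i in t] == S))
   \det (\matrix_(i, j) (if i \in S then M i j else (i == j)%:R))).
  congr (_ * _); apply: eq_bigr => t /andP[ut /eqP <-].
  rewrite -det_principal_minor //; congr (\det _).
  by apply/matrixP => i j; rewrite !mxE inE.
rewrite sumr_const [X in _ * (_ *+ X)](_ : _ = k`!).
  by rewrite -[X in _ * X]mulr_natl mulKf // pnatr_eq0 -lt0n fact_gt0.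
rewrite -[RHS]ffactnn -[X in X ^_ _]cS -card_uniq_tuples cardsE.
apply: eq_card => t; rewrite -!topredE /= andbC.
case ut: (uniq t); rewrite ?andbF // !andbT; apply/esym.
apply/idP/eqP => [/allP st|<-]; last first.
  by apply/allP => i it; have : i \in [set i in t] by rewrite inE.
apply/eqP; rewrite eqEcard cS cardsE (card_uniqP ut) size_tuple leqnn andbT.
by apply/fintype.subsetP => i; rewrite inE; exact: st.
Qed.

Lemma det_add1_minor_sum (R : numFieldType) (n N : nat) (M : 'M[R]_n) :
  (n < N)%N -> \det (1%:M + M) = \sum_(k < N) minor_sum M k.
Proof.
move=> nN; rewrite addrC det_add_rows.
have cS (S : {set 'I_n}) : (#|S| < N)%N.
  by rewrite (leq_ltn_trans _ nN) // -[n in (_ <= n)%N]card_ord max_card.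
rewrite (partition_big (fun S => Ordinal (cS S)) xpredT) //=.
apply: eq_bigr => k _; rewrite minor_sumE; apply: eq_big => S.
  by rewrite -val_eqE.
move=> _; congr (\det _); by apply/matrixP => i j; rewrite !mxE.
Qed.

(* [Q] is the Householder reflection sending [r] to a multiple of [e_0]. *)
Lemma ex_orthogonal_row (R : rcfType) (n : nat) (r : 'rV[R]_n.+1) :
  exists (Q : 'M[R]_n.+1) (s : R), [/\ Q *m Q^T = 1%:M,
    r *m Q = s *: delta_mx 0 0 & s ^+ 2 = \sum_j r 0 j ^+ 2].
Proof.
pose e : 'rV[R]_n.+1 := delta_mx 0 0.
pose S := \sum_j r 0 j ^+ 2.
have S0 : 0 <= S by apply: sumr_ge0 => j _; exact: sqr_ge0.
pose s := Num.sqrt S; have s2 : s ^+ 2 = S by rewrite sqr_sqrtr.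
pose v := r - s *: e.
have [v0|v0] := eqVneq v 0.
  exists 1%:M, s; split => //; first by rewrite trmx1 mulmx1.
  by rewrite mulmx1; apply/eqP; rewrite -subr_eq0 -/e -/v v0.
pose V := (v *m v^T) 0 0.
have VE : v *m v^T = V%:M by exact: mx11_scalar.
have rr : (r *m r^T) 0 0 = S.
  by rewrite mxE; apply: eq_bigr => j _; rewrite mxE expr2.
have re : (r *m e^T) 0 0 = r 0 0.
  rewrite mxE (bigD1 0) //= big1 ?addr0 => [|j nj]; rewrite !mxE ?eqxx ?mulr1 //.
  by rewrite (negPf nj) mulr0.
have er : (e *m r^T) 0 0 = r 0 0.
  rewrite mxE (bigD1 0) //= big1 ?addr0 => [|j nj]; rewrite !mxE ?eqxx ?mul1r //.
  by rewrite (negPf nj) mul0r.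
have ee : (e *m e^T) 0 0 = 1.
  rewrite mxE (bigD1 0) //= big1 ?addr0 => [|j nj]; rewrite !mxE ?eqxx ?mulr1 //.
  by rewrite (negPf nj) mulr0.
have rvE : (r *m v^T) 0 0 = S - s * r 0 0.
  rewrite /v raddfB /= mulmxBr linearZ /= -scalemxAr mxE rr.
  by rewrite [X in _ + X]mxE [X in - X]mxE re.
have evE : (e *m v^T) 0 0 = r 0 0 - s.
  rewrite /v raddfB /= mulmxBr linearZ /= -scalemxAr mxE er.
  by rewrite [X in _ + X]mxE [X in - X]mxE ee mulr1.
have V2 : V = 2 * (S - s * r 0 0).
  rewrite /V {1}/v mulmxBl -scalemxAl mxE.
  rewrite [X in _ + X]mxE [X in - X]mxE rvE evE mulrBr -expr2 s2.
  by rewrite mulr2n mulrDl !mul1r opprB.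
have Vn : V != 0.
  apply: contra v0 => /eqP V0; apply/eqP/rowP => j; rewrite [RHS]mxE.
  have : \sum_j v 0 j ^+ 2 = 0.
    by rewrite -[RHS]V0 /V mxE; apply: eq_bigr => i _; rewrite [v^T _ _]mxE expr2.
  move/eqP; rewrite psumr_eq0 => [/allP/(_ j)|i _]; last exact: sqr_ge0.
  by rewrite mem_index_enum => /(_ isT) /=; rewrite sqrf_eq0 => /eqP.
pose Q : 'M[R]_n.+1 := 1%:M - (2 / V) *: (v^T *m v).
have QT : Q^T = Q.
  by rewrite /Q raddfB /= trmx1 linearZ /= trmx_mul trmxK.
exists Q, s; split => //.
- have WW : v^T *m v *m (v^T *m v) = V *: (v^T *m v).
    by rewrite mulmxA -[v^T *m v *m v^T]mulmxA VE mul_mx_scalar -scalemxAl.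
  rewrite QT /Q mulmxBr mulmxBl mul1mx mulmx1 mulmxBl mul1mx.
  rewrite -scalemxAl -scalemxAr WW !scalerA.
  rewrite (_ : 2 / V * (2 / V) * V = 2 / V + 2 / V); last first.
    by rewrite -mulrA divfK // mulr_natr mulr2n.
  by rewrite scalerDl opprB addrK subrK.
- rewrite /Q mulmxBr mulmx1 -scalemxAr mulmxA [r *m _]mx11_scalar rvE.
  rewrite mul_scalar_mx scalerA V2 invfM mulrA divff ?pnatr_eq0 // mul1r.
  rewrite mulVf ?scale1r; last first.
    by apply: contra Vn => /eqP S1; rewrite V2 S1 mulr0.
  by rewrite opprB addrC subrK.
Qed.

(** Induction on the size. Multiplication by an orthogonal [Q] changes neither the squared
    determinant nor the row norms, and can bring the first row to [s e_0]. Expanding along that row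
    leaves a minor whose rows have lost their first entry, so their norms have not grown. *)
Lemma hadamard (R : rcfType) (n : nat) (M : 'M[R]_n) :
  \det M ^+ 2 <= \prod_i \sum_j M i j ^+ 2.
Proof.
elim: n => [|n IH] in M *; first by rewrite det_mx00 big_ord0 expr1n.
have [Q [s [QQ rQ s2]]] := ex_orthogonal_row (row 0 M).
have dQ : \det Q ^+ 2 = 1.
  by rewrite expr2 -{2}det_tr -det_mulmx QQ det1.
pose N := M *m Q.
have dN : \det N ^+ 2 = \det M ^+ 2.
  by rewrite /N det_mulmx exprMn dQ mulr1.
have rN i : \sum_j N i j ^+ 2 = \sum_j M i j ^+ 2.
  have E (K : 'M[R]_n.+1) : \sum_j K i j ^+ 2 = (K *m K^T) i i.
    by rewrite mxE; apply: eq_bigr => j _; rewrite mxE expr2.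
  by rewrite !E /N trmx_mul mulmxA -[M *m Q *m _]mulmxA QQ mulmx1.
rewrite -dN big_ord_recl /=.
have N0 j : N 0 j = s * (j == 0)%:R.
  have := congr1 (fun K : 'rV[R]_n.+1 => K 0 j) rQ.
  rewrite -row_mul -/N [LHS]mxE => ->; rewrite !mxE.
  by rewrite eqxx.
rewrite (expand_det_row _ 0) (bigD1 0) //= big1 => [|j nj]; last first.
  by rewrite N0 (negPf nj) mulr0 mul0r.
rewrite N0 eqxx mulr1 addr0 /cofactor addn0 expr0 mul1r exprMn.
have -> : \sum_j M 0 j ^+ 2 = s ^+ 2.
  by rewrite s2; apply: eq_bigr => j _; rewrite mxE.
apply: ler_wpM2l; first exact: sqr_ge0.
apply: (le_trans (IH _)); apply: ler_prod => i _.
rewrite sumr_ge0 => [|j _]; last exact: sqr_ge0.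
rewrite -rN [leRHS]big_ord_recl /= -[leLHS]add0r lerD ?sqr_ge0 //.
by apply: ler_sum => j _; rewrite !mxE.
Qed.

Lemma hadamard_bound (R : rcfType) (n : nat) (M : 'M[R]_n) (B : R) :
  (forall i j, `|M i j| <= B) -> \det M ^+ 2 <= (n%:R * B ^+ 2) ^+ n.
Proof.
move=> MB; apply: (le_trans (hadamard M)).
rewrite -[X in _ ^+ X]card_ord -prodr_const; apply: ler_prod => i _.
rewrite sumr_ge0 /= => [|j _]; last exact: sqr_ge0.
rewrite -[X in X%:R]card_ord mulr_natl -sumr_const; apply: ler_sum => j _.
by rewrite -real_normK ?num_real // lerXn2r ?nnegrE // (le_trans _ (MB i j)).
Qed.

(** * Uniform continuity, and extension of the kernels to the whole plane *)

Lemma heine_cantor2 (R : realType) (D : set (R * R)) (f : R * R -> R) :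
  compact D -> {within D, continuous f} ->
  forall e : R, 0 < e -> exists2 d : R, 0 < d &
    forall z w, D z -> D w -> `|z.1 - w.1| < d -> `|z.2 - w.2| < d ->
      `|f z - f w| <= e.
Proof.
move=> /compact_near_coveringP/near_covering_withinP cD.
move=> /subspace_continuousP cf e e0.
pose P (d : R) (z : R * R) := forall w, D w ->
   `|z.1 - w.1| < d -> `|z.2 - w.2| < d -> `|f z - f w| <= e.
(* Half the radius that works at [z] serves every center close to [z]; near-covering compactness
   turns these local radii into a single [d]. *)
have H : \forall d \near (0 : R)^'+, D `<=` P d.
  apply: cD => z Dz.
  have e2 : 0 < e / 2 by rewrite divr_gt0.
  have /cvgrPdist_le/(_ _ e2) := cf z Dz.
  move=> /nbhs_ballP[r /= r0 rP].
  have r2 : 0 < r / 2 by rewrite divr_gt0.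
  exists (ball z (r / 2), [set d : R | d < r / 2]).
    split => /=; first exact: nbhsx_ballx.
    exact: nbhs_right_lt.
  move=> [z' d] [] /= [z1 z2] dr Dz' w Dw w1 w2.
  rewrite /ball /= in z1 z2.
  have Bz' : ball z r z' by split; rewrite /ball /=; lra.
  have Bw : ball z r w.
    split; rewrite /ball /=.
      rewrite -(subrKA z'.1) (le_lt_trans (ler_normD _ _)) //; lra.
    rewrite -(subrKA z'.2) (le_lt_trans (ler_normD _ _)) //; lra.
  have h1 := rP _ Bz' Dz'; have h2 := rP _ Bw Dw.
  rewrite -(subrKA (f z)) (le_trans (ler_normD _ _)) // distrC.
  by rewrite [leRHS]splitr lerD.
near (0 : R)^'+ => d; exists d; first by near: d; exact: nbhs_right_gt.
move=> z w Dz Dw; have := near H d; apply => //; by near: d.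
Unshelve. all: end_near. Qed.

Lemma triangle_compact (R : realType) :
  compact [set z : R * R | 0 <= z.1 <= 1 /\ 0 <= z.2 <= z.1].
Proof.
rewrite (_ : [set _ | _] = (`[0, 1] `*` `[0, 1]) `&` [set z : R * R | z.2 <= z.1]).
  apply: compact_closedI; first by apply: compact_setX; exact: segment_compact.
  rewrite (_ : mkset _ = (fun z : R * R => z.1 - z.2) @^-1` [set x | 0 <= x]).
    apply: closed_comp; last exact: closed_ge.
    by move=> z _; apply: cvgB; [exact: cvg_fst|exact: cvg_snd].
  by apply/seteqP; split => z /=; rewrite subr_ge0.
apply/seteqP; split => z /=; rewrite !in_itv /=.
  by move=> [/andP[a b] /andP[c d]]; rewrite a b c (le_trans d b).
by move=> [[-> /andP[-> _]] ->].
Qed.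

Lemma square_compact (R : realType) :
  compact [set z : R * R | 0 <= z.1 <= 1 /\ 0 <= z.2 <= 1].
Proof.
rewrite (_ : [set _ | _] = `[0, 1] `*` `[0, 1]).
  by apply: compact_setX; exact: segment_compact.
by apply/seteqP; split => z /=; rewrite !in_itv.
Qed.

Definition clamp01 (R : realType) (x : R) : R := Num.max 0 (Num.min x 1).

Lemma clamp01_itv (R : realType) (x : R) : 0 <= clamp01 x <= 1.
Proof. by rewrite le_max lexx /= ge_max ler01 ge_min lexx orbT. Qed.

Lemma clamp01_id (R : realType) (x : R) : 0 <= x <= 1 -> clamp01 x = x.
Proof. by move=> /andP[x0 x1]; rewrite /clamp01 (min_idPl x1) (max_idPr x0). Qed.

Lemma clamp01_lip (R : realType) (x y : R) :
  `|clamp01 x - clamp01 y| <= `|x - y|.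
Proof.
have := ler_norm (x - y); have := ler_norm (y - x); rewrite distrC ler_norml.
by rewrite /clamp01 /Num.max /Num.min; do ![case: ifP => //]; lra.
Qed.

Lemma max_lt_dist (R : realType) (d x y x' y' : R) :
  `|x - x'| < d -> `|y - y'| < d -> `|Num.max x y - Num.max x' y'| < d.
Proof.
rewrite !ltr_norml => /andP[? ?] /andP[? ?].
by rewrite /Num.max; do ![case: ifP => //]; lra.
Qed.

Lemma min_lt_dist (R : realType) (d x y x' y' : R) :
  `|x - x'| < d -> `|y - y'| < d -> `|Num.min x y - Num.min x' y'| < d.
Proof.
rewrite !ltr_norml => /andP[? ?] /andP[? ?].
by rewrite /Num.min; do ![case: ifP => //]; lra.
Qed.

(** Both kernels are replaced by extensions of this kind, so that bounds, moduli of continuity and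
    measurability of slices hold on the whole line, with no restriction to the square. *)
Definition bdd_ucont2 (R : realType) (K : R -> R -> R) :=
  (exists B, forall x y, `|K x y| <= B) /\
  (forall e, 0 < e -> exists2 d, 0 < d & forall x x' y y',
     `|x - x'| < d -> `|y - y'| < d -> `|K x y - K x' y'| <= e).

Lemma compact_bdd_fun (R : realType) (D : set (R * R)) (f : R * R -> R) :
  compact D -> {within D, continuous f} ->
  exists B, forall z, D z -> `|f z| <= B.
Proof.
move=> cD cf.
have /compact_bounded[M [_ MP]] := continuous_compact cf cD.
exists (M + 1) => z Dz; apply: (MP (M + 1)); first by rewrite ltrDl.
by exists z.
Qed.

Lemma square_extension (R : realType) (K : R -> R -> R) :
  continuous_on_square K -> exists2 K', bdd_ucont2 K' &
    forall x y, 0 <= x <= 1 -> 0 <= y <= 1 -> K' x y = K x y.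
Proof.
move=> cK; exists (fun x y => K (clamp01 x) (clamp01 y)); last first.
  by move=> x y x1 y1; rewrite !clamp01_id.
split.
  have [B hB] := compact_bdd_fun (@square_compact R) cK.
  by exists B => x y; apply: (hB (_, _)); split; exact: clamp01_itv.
move=> e e0; have [d d0 hd] := heine_cantor2 (@square_compact R) cK e0.
exists d => // x x' y y' xx yy.
by apply: (hd (_, _) (_, _)); try (split; exact: clamp01_itv);
  apply: (le_lt_trans (clamp01_lip _ _)).
Qed.

(* [K'] reflects the values of [K] below the diagonal across it. *)
Lemma triangle_extension (R : realType) (K : R -> R -> R) :
  continuous_on_lower_triangle K -> exists K', [/\ bdd_ucont2 K',
    (forall x y, K' x y = K' y x) &
    forall x y, 0 <= y -> y <= x -> x <= 1 -> K' x y = K x y].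
Proof.
move=> cK; exists (fun x y => K (clamp01 (Num.max x y)) (clamp01 (Num.min x y))).
have tri (x y : R) : 0 <= clamp01 (Num.max x y) <= 1 /\
    0 <= clamp01 (Num.min x y) <= clamp01 (Num.max x y).
  split; first exact: clamp01_itv.
  have /andP[-> _] /= := clamp01_itv (Num.min x y).
  by rewrite /clamp01 /Num.max /Num.min; do ![case: ifP => //]; lra.
split.
- split.
    have [B hB] := compact_bdd_fun (@triangle_compact R) cK.
    by exists B => x y; apply: (hB (_, _)); exact: tri.
  move=> e e0; have [d d0 hd] := heine_cantor2 (@triangle_compact R) cK e0.
  exists d => // x x' y y' xx yy.
  apply: (hd (_, _) (_, _)); [exact: tri|exact: tri| |];
    apply: (le_lt_trans (clamp01_lip _ _)).
  - exact: max_lt_dist.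
  - exact: min_lt_dist.
- by move=> x y; rewrite maxC minC.
- move=> x y y0 yx x1; rewrite (max_idPl yx) (min_idPr yx) !clamp01_id //.
    by rewrite y0 (le_trans yx).
  by rewrite x1 (le_trans y0).
Qed.

(** * Integration over [0,1], indicators of intervals, and elements of L^2 *)

Definition int01 (R : realType) (u : R -> R) : R :=
  \int[lebesgue_measure]_(t in `[0, 1]) u t.

Definition itg01 (R : realType) (u : R -> R) : Prop :=
  (@lebesgue_measure R).-integrable `[0, 1] (EFin \o u).

Definition ae01 (R : realType) (P : R -> Prop) : Prop :=
  {ae (lebesgue_measure : {measure set (measurableTypeR R) -> \bar R}),
    forall t, 0 <= t <= 1 -> P t}.

(** Half-open, so that the indicators of adjacent cells add up exactly to that of their union. *)
Definition ind (R : realType) (a b x : R) : R := ((a <= x) && (x < b))%:R.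

Lemma itg01_bounded (R : realType) (u : R -> R) (C : R) :
  measurable_fun setT u -> (forall x, `|u x| <= C) -> itg01 u.
Proof.
move=> mu uC; apply: measurable_bounded_integrable => //=.
- by rewrite lebesgue_measure_itv /= lte_fin ltr01 ltry.
- exact: measurable_funS mu.
- exists C; split; first exact: num_real.
  by move=> M CM x _; apply: (le_trans (uC x)); exact: ltW.
Qed.

Lemma itg01_le (R : realType) (u v : R -> R) :
  measurable_fun setT u -> (forall x, `|u x| <= `|v x|) -> itg01 v -> itg01 u.
Proof.
move=> mu uv; apply: le_integrable => //.
- by apply/measurable_EFinP; exact: measurable_funS mu.
- by move=> x _; rewrite lee_fin.
Qed.

Lemma itg01Z (R : realType) (c : R) (u : R -> R) :
  itg01 u -> itg01 (fun x => c * u x).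
Proof. by rewrite /itg01 => iu; apply: (integrableZl _ c iu). Qed.

Lemma itg01_mul (R : realType) (u v : R -> R) (C : R) :
  measurable_fun setT u -> (forall x, `|u x| <= C) ->
  measurable_fun setT v -> itg01 v -> itg01 (fun x => u x * v x).
Proof.
move=> mu uC mv iv; apply: (itg01_le (v := fun x => C * v x)).
- exact: measurable_funM.
- move=> x; rewrite !normrM ler_wpM2r // (le_trans (uC x)) //.
  exact: ler_norm.
- exact: itg01Z.
Qed.

Lemma itg01D (R : realType) (u v : R -> R) :
  itg01 u -> itg01 v -> itg01 (fun x => u x + v x).
Proof. by rewrite /itg01 => iu iv; apply: (integrableD _ iu iv). Qed.

Lemma itg01_norm (R : realType) (u : R -> R) :
  itg01 u -> itg01 (fun x => `|u x|).
Proof. exact: integrable_norm. Qed.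

Lemma itg01_cst (R : realType) (c : R) : itg01 (fun=> c).
Proof. by apply: (itg01_bounded (C := `|c|)). Qed.

Lemma int01D (R : realType) (u v : R -> R) :
  itg01 u -> itg01 v ->
  int01 (fun x => u x + v x) = int01 u + int01 v.
Proof. by move=> iu iv; apply: RintegralD. Qed.

Lemma int01B (R : realType) (u v : R -> R) :
  itg01 u -> itg01 v ->
  int01 (fun x => u x - v x) = int01 u - int01 v.
Proof. by move=> iu iv; apply: RintegralB. Qed.

Lemma int01Z (R : realType) (c : R) (u : R -> R) :
  itg01 u -> int01 (fun x => c * u x) = c * int01 u.
Proof. by move=> iu; apply: RintegralZl. Qed.

Lemma int01_cst (R : realType) (c : R) : int01 (fun=> c) = c.
Proof.
rewrite /int01 Rintegral_cst //= lebesgue_measure_itv /= lte_fin ltr01.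
by rewrite oppr0 adde0 mulr1.
Qed.

Lemma le_int01 (R : realType) (u v : R -> R) :
  itg01 u -> itg01 v -> (forall x, 0 <= x <= 1 -> u x <= v x) ->
  int01 u <= int01 v.
Proof.
by move=> iu iv uv; apply: le_Rintegral => // x; rewrite /= in_itv; exact: uv.
Qed.

Lemma eq_int01 (R : realType) (u v : R -> R) :
  (forall x, 0 <= x <= 1 -> u x = v x) -> int01 u = int01 v.
Proof.
by move=> uv; apply: eq_Rintegral => x; rewrite inE /= in_itv; exact: uv.
Qed.

Lemma ae_eq_int01 (R : realType) (u v : R -> R) :
  measurable_fun setT u -> measurable_fun setT v ->
  ae01 (fun t => u t = v t) -> int01 u = int01 v.
Proof.
move=> mu mv uv; congr fine; apply: ae_eq_integral => //.
- by apply/measurable_EFinP; exact: measurable_funS mu.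
- by apply/measurable_EFinP; exact: measurable_funS mv.
- case: uv => N [mN N0 sN]; exists N; split => //.
  apply: subset_trans sN => x /=; apply: contra_not => h.
  by rewrite in_itv /= => /h ->.
Qed.

Lemma norm_int01 (R : realType) (u : R -> R) :
  itg01 u -> `|int01 u| <= int01 (fun x => `|u x|).
Proof. by move=> iu; apply: le_normr_Rintegral. Qed.

Lemma measurable_ind (R : realType) (a b : R) : measurable_fun setT (ind a b).
Proof.
rewrite (_ : ind a b = \1_(`[a, b[)); first exact: measurable_indic.
by apply/funext => x; rewrite /ind indicE mem_setE in_itv.
Qed.

Lemma norm_ind (R : realType) (a b x : R) : `|ind a b x| <= 1.
Proof. by rewrite /ind; case: (_ && _); rewrite ?normr1 ?normr0. Qed.

Lemma ind_ge0 (R : realType) (a b x : R) : 0 <= ind a b x.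
Proof. by rewrite /ind ler0n. Qed.

Lemma itg01_ind (R : realType) (a b : R) : itg01 (ind a b).
Proof. exact: itg01_bounded (@measurable_ind R a b) (@norm_ind R a b). Qed.

Lemma int01_ind (R : realType) (a b : R) :
  0 <= a -> a <= b -> b <= 1 -> int01 (ind a b) = b - a.
Proof.
move=> a0 ab b1.
transitivity (\int[@lebesgue_measure R]_(t in `[0, 1] `&` `[a, b[) 1).
  rewrite Rintegral_mkcondr; apply: eq_Rintegral => x _.
  rewrite /ind patchE mem_setE in_itv /=; by case: (_ && _).
rewrite setIidr => [|x /=].
  rewrite Rintegral_cst //= lebesgue_measure_itv /= lte_fin.
  case: ltP => [_|ba]; rewrite mul1r //.
  have -> : a = b by apply/eqP; rewrite eq_le ab.
  by rewrite subrr.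
rewrite !in_itv /= => /andP[ax xb].
by rewrite (le_trans a0) // (le_trans (ltW xb)).
Qed.

Lemma ae_leb01 (R : realType) (u v : R -> R) :
  u = v %[ae leb01 R] -> ae01 (fun t => u t = v t).
Proof.
move=> [N [mN N0 sN]]; exists (N `&` `[0, 1]); split.
- by apply: measurableI.
- exact: N0.
- move=> t /= h; have [tI|tI] := boolP (0 <= t <= 1); last first.
    by exfalso; apply: h; rewrite (negPf tI).
  split; last by rewrite /= in_itv.
  by apply: sN => /= e; apply: h => _; exact: e.
Qed.

Lemma ae01_and (R : realType) (P Q : R -> Prop) :
  ae01 P -> ae01 Q -> ae01 (fun t => P t /\ Q t).
Proof.
move=> [N [mN N0 sN]] [M [mM M0 sM]]; exists (N `|` M); split.
- exact: measurableU.
- exact: null_set_setU.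
- move=> t /= h; have [nP|nP] := pselect (0 <= t <= 1 -> P t); last first.
    by left; exact: sN.
  by right; apply: sM => /= hQ; apply: h => t1; split; [exact: nP|exact: hQ].
Qed.

Lemma ae01_imp (R : realType) (P Q : R -> Prop) :
  (forall t, 0 <= t <= 1 -> P t -> Q t) -> ae01 P -> ae01 Q.
Proof.
move=> PQ [N [mN N0 sN]]; exists N; split => //.
by apply: subset_trans sN => t /=; apply: contra_not => h t1; apply: PQ => //; exact: h.
Qed.

Lemma L2_measurable (R : realType) (f : L2 R) : measurable_fun setT (f : R -> R).
Proof. exact: (@measurable_funPT _ _ _ _ f). Qed.

(** L^2 is contained in L^1 because [leb01] has finite total mass. *)
Lemma L2_itg01 (R : realType) (f : L2 R) : itg01 f.
Proof.
have fin : leb01 R setT \is a fin_num.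
  rewrite /leb01 /= /mrestr setTI lebesgue_measure_itv /= lte_fin ltr01.
  by rewrite -EFinD.
have := @Lfun_subset _ _ R (leb01 R) 1 2%:E (lexx _) (lee1n 2) fin (lee1n 2).
move=> /(_ _ (LfunP f)) /Lfun1_integrable /integrableP[mf ff].
apply/integrableP; split; first exact: measurable_funS mf.
have -> : (\int[lebesgue_measure]_(x in `[0%R, 1%R]) `|(EFin \o f) x| =
   \int[leb01 R]_(x in `[0%R, 1%R]) `|(EFin \o f) x|)%E.
  by apply: eq_measure_integral => A mA As; rewrite /leb01 /= /mrestr setIidl.
apply: le_lt_trans ff; apply: ge0_subset_integral => //.
exact: measurableT_comp.
Qed.

Lemma L2_of_bounded (R : realType) (u : R -> R) (C : R) :
  measurable_fun setT u -> (forall x, `|u x| <= C) ->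
  exists f : L2 R, (f : R -> R) = u.
Proof.
move=> mu uC.
have uL : u \in Lfun (leb01 R) 2%:E.
  apply/andP; split; rewrite inE //=.
  rewrite /finite_norm unlock /Lnorm /=.
  apply: poweR_lty.
  apply: le_lt_trans (_ : (\int[leb01 R]_x (C ^+ 2)%:E < +oo)%E); last first.
    rewrite integral_cst //= /mrestr setTI lebesgue_measure_itv /= lte_fin ltr01.
    by rewrite -EFinD -EFinM ltry.
  apply: ge0_le_integral => //.
  - apply/measurable_EFinP.
    by apply: (@measurableT_comp _ _ _ _ _ _ (@powR R ^~ 2)) => //;
       exact: measurableT_comp.
  - move=> x _; rewrite lee_fin -powR_mulrn ?(le_trans _ (uC x)) //.
    by rewrite ge0_ler_powR // nnegrE // (le_trans _ (uC x)).
by exists (Lfun_Sub (lee1n 2) uL).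
Qed.

Definition ucont1 (R : realType) (u : R -> R) := forall e : R, 0 < e ->
  exists2 d, 0 < d & forall x y, `|x - y| < d -> `|u x - u y| <= e.

Lemma ucont1_measurable (R : realType) (u : R -> R) :
  ucont1 u -> measurable_fun setT u.
Proof.
move=> cu; apply: continuous_measurable_fun => x.
apply/cvgrPdist_le => e /cu[d d0 ud].
apply/nbhs_ballP; exists d => //= y xy; exact: ud.
Qed.

Lemma measurable_slice (R : realType) (K : R -> R -> R) (x : R) :
  bdd_ucont2 K -> measurable_fun setT (K x).
Proof.
move=> [_ cK]; apply: ucont1_measurable => e /cK[d d0 Kd].
by exists d => // y y'; apply: Kd; rewrite subrr normr0.
Qed.

Lemma le_int01_ae (R : realType) (u v : R -> R) :
  measurable_fun setT u -> measurable_fun setT v -> itg01 u -> itg01 v ->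
  ae01 (fun t => u t <= v t) -> int01 u <= int01 v.
Proof.
move=> mu mv iu iv uv.
(* The minimum of [u] and [v] equals [u] almost everywhere and lies below [v] everywhere, which
   reduces the claim to the pointwise comparison. *)
have mm : measurable_fun setT (fun t => Num.min (u t) (v t)) by exact: measurable_minr.
have E : int01 u = int01 (fun t => Num.min (u t) (v t)).
  by apply: ae_eq_int01 => //; apply: ae01_imp uv => t _ /min_idPl.
rewrite E; apply: le_int01 => //; last by move=> x _; rewrite ge_min lexx orbT.
have iuv : itg01 (fun t => `|u t| + `|v t|).
  by apply: itg01D; exact: itg01_norm.
apply: itg01_le iuv => // x.
rewrite [leRHS]ger0_norm ?addr_ge0 // /Num.min.
by case: ifP => _; rewrite ?lerDl ?lerDr.
Qed.

Lemma itg01_ind_mul (R : realType) (a b : R) (u : R -> R) :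
  measurable_fun setT u -> itg01 u -> itg01 (fun x => ind a b x * u x).
Proof.
by move=> mu iu; apply: (itg01_mul (C := 1)) => //;
  [exact: measurable_ind|exact: norm_ind].
Qed.

Lemma norm_int01_le (R : realType) (u v : R -> R) :
  measurable_fun setT u -> itg01 u -> measurable_fun setT v -> itg01 v ->
  ae01 (fun t => `|u t| <= v t) -> `|int01 u| <= int01 v.
Proof.
move=> mu iu mv iv uv; apply: (le_trans (norm_int01 iu)).
by apply: le_int01_ae => //; [exact: measurableT_comp|exact: itg01_norm].
Qed.

(** The tool for every passage from an integral over a short interval to a point value. Closeness is
    required only almost everywhere because the images under [A], [T] and [Tadj] are known only
    so. *)
Lemma int01_ind_approx (R : realType) (a b c e : R) (u : R -> R) :
  0 <= a -> a <= b -> b <= 1 -> measurable_fun setT u -> itg01 u ->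
  ae01 (fun x => a <= x -> x < b -> `|u x - c| <= e) ->
  `|int01 (fun x => ind a b x * u x) - (b - a) * c| <= (b - a) * e.
Proof.
move=> a0 ab b1 mu iu uc.
have iu' := itg01_ind_mul a b mu iu.
have iZ r : itg01 (fun x => r * ind a b x) by exact/itg01Z/itg01_ind.
have mZ r : measurable_fun setT (fun x => r * ind a b x).
  by apply: measurable_funM => //; exact: measurable_ind.
have E r : (b - a) * r = int01 (fun x => r * ind a b x).
  by rewrite int01Z ?int01_ind 1?mulrC //; exact: itg01_ind.
rewrite !E -int01B //.
apply: norm_int01_le => //.
- apply: measurable_funB => //; apply: measurable_funM => //.
  exact: measurable_ind.
- have -> : (fun x => ind a b x * u x - c * ind a b x) =
      (fun x => ind a b x * u x + - c * ind a b x).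
    by apply/funext => x; rewrite mulNr.
  by apply: itg01D.
- apply: ae01_imp uc => x _.
  rewrite [c * _]mulrC -mulrBr normrM (ger0_norm (ind_ge0 _ _ _)) [e * _]mulrC.
  rewrite /ind; case: andP => [[ax xb]|_]; last by rewrite !mul0r.
  by move=> /(_ ax xb); rewrite !mul1r.
Qed.

(** * From the operator factorization to a pointwise identity of kernels *)

(** The boolean factor confines the discontinuity of the kernel of [T] to the diagonal; all
    estimates use the uniform continuity of [tau] and treat the cut-off separately. *)
Definition low (R : realType) (tau : R -> R -> R) (t s : R) : R :=
  (s <= t)%R%:R * tau t s.

Lemma measurable_le_cst (R : realType) (t : R) :
  measurable_fun setT (fun s : R => (s <= t)%R%:R : R).
Proof.
rewrite (_ : (fun s : R => (s <= t)%R%:R : R) = \1_(`]-oo, t])).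
  exact: measurable_indic.
by apply/funext => x; rewrite indicE mem_setE in_itv.
Qed.

Lemma measurable_low (R : realType) (tau : R -> R -> R) (t : R) :
  bdd_ucont2 tau -> measurable_fun setT (low tau t).
Proof.
move=> ct; apply: measurable_funM; last exact: measurable_slice.
exact: measurable_le_cst.
Qed.

Lemma norm_low (R : realType) (tau : R -> R -> R) (B t s : R) :
  (forall x y, `|tau x y| <= B) -> `|low tau t s| <= B.
Proof.
move=> tB; have B0 : 0 <= B by apply: le_trans (tB 0 0).
by rewrite /low; case: (s <= t); rewrite ?mul1r // mul0r normr0.
Qed.

(* The hypotheses of the theorem with [tau] the symmetric extension of the kernel
   of [T], which is therefore [low tau] on the unit square. *)
Record lower_factor (R : realType) (kA tau : R -> R -> R)
    (A T Tadj : L2 R -> L2 R) : Prop := LowerFactor {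
  lf_A : forall f : L2 R, ae01 (fun t => A f t = int01 (fun s => kA t s * f s));
  lf_T : forall f : L2 R,
    ae01 (fun t => T f t = int01 (fun s => low tau t s * f s));
  lf_adj : forall u f : L2 R,
    int01 (fun t => T u t * f t) = int01 (fun t => u t * Tadj f t);
  lf_dec : forall f : L2 R,
    ae01 (fun t => A f t = Tadj f t + T f t + T (Tadj f) t)
}.

Lemma lf_intro (R : realType)
  (kA : R -> R -> R) (A : L2 R -> L2 R)
  (kT : R -> R -> R) (T Tadj : L2 R -> L2 R)
  (hA : integral_operator kA A)
  (hkT0 : triangular_kernel kT)
  (hT : integral_operator kT T)
  (hTadj : is_adjoint T Tadj)
  (hdec : L2_op_eq (id_plus A) (id_plus T \o id_plus Tadj))
  (KA tau : R -> R -> R) :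
  bdd_ucont2 tau ->
  (forall x y, 0 <= x <= 1 -> 0 <= y <= 1 -> KA x y = kA x y) ->
  (forall x y, 0 <= y -> y <= x -> x <= 1 -> tau x y = kT x y) ->
  lower_factor KA tau A T Tadj.
Proof.
move=> ct HA Htau; have [[B tB] _] := ct.
have HT (f : L2 R) : ae01 (fun t => T f t = int01 (fun s => low tau t s * f s)).
  apply: ae01_imp (ae_leb01 (hT f)) => t /andP[t0 t1] ->.
  apply: eq_int01 => s /andP[s0 s1]; congr (_ * _).
  rewrite /low; case: leP => [st|ts]; first by rewrite mul1r Htau.
  by rewrite mul0r hkT0 ?t0 ?s0.
split => //.
- move=> f; apply: ae01_imp (ae_leb01 (hA f)) => t t01 ->.
  by apply: eq_int01 => s s01; rewrite HA.
- move=> f.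
  (* [T] is not assumed linear: [T (f + Tadj f)] is split through its integral formula, at almost
     every point, and [f t] is then cancelled. *)
  have := ae01_and (ae_leb01 (hdec f)) (ae01_and (HT (f + Tadj f))
    (ae01_and (HT f) (HT (Tadj f)))).
  apply: ae01_imp => t _ [] + [] + [].
  have LD (u v : L2 R) x : (u + v) x = u x + v x by [].
  move=> e1 e2 e3 e4.
  have {}e1 : f t + A f t = f t + Tadj f t + T (f + Tadj f) t := e1.
  apply: (@addrI _ (f t)); rewrite e1 e2 e3 e4 -!addrA; congr (_ + (_ + _)).
  rewrite -int01D; last 2 first.
  - apply: (itg01_mul (C := B)); [exact: measurable_low| |exact: L2_measurable|
      exact: L2_itg01].
    by move=> s; exact: norm_low.
  - apply: (itg01_mul (C := B)); [exact: measurable_low| |exact: L2_measurable|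
      exact: L2_itg01].
    by move=> s; exact: norm_low.
  by apply: eq_int01 => s _; rewrite -mulrDr.
Qed.

Lemma itg01_L2_mul (R : realType) (u : R -> R) (C : R) (f : L2 R) :
  measurable_fun setT u -> (forall x, `|u x| <= C) ->
  itg01 (fun t => u t * f t).
Proof.
by move=> mu uC; apply: (itg01_mul (C := C)) => //;
  [exact: L2_measurable|exact: L2_itg01].
Qed.

Lemma measurable_sgr (R : realType) : measurable_fun setT (@Num.sg R).
Proof.
apply: nondecreasing_measurable => // x y xy.
case: (sgrP x) xy => [->|x0|x0] xy; case: (sgrP y) => [y0|y0|y0] //; lra.
Qed.

(* Test the factorization against [h = 1_[x,x+d[] and [f = 1_[y,y+d[], whose
   supports are ordered.  No Fubini theorem is needed: [<h, T (T^* f)>] is compared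
   with [d <low tau x, T^* f> = d <T (low tau x), f>]. *)
Section main_estimate.
Context (R : realType) (KA tau : R -> R -> R) (A T Tadj : L2 R -> L2 R).
Context (B d e x y : R) (h f : L2 R).
Hypotheses (ct : bdd_ucont2 tau) (tB : forall p q, `|tau p q| <= B).
Hypotheses (cA : bdd_ucont2 KA) (lf : lower_factor KA tau A T Tadj).
Hypotheses (y0 : 0 <= y) (d0 : 0 < d) (yx : y + d <= x) (x1 : x + d <= 1).
Hypothesis te : forall p p' q q', `|p - p'| <= d -> `|q - q'| <= d ->
   `|tau p q - tau p' q'| <= e.
Hypothesis Ae : forall p p' q q', `|p - p'| <= d -> `|q - q'| <= d ->
   `|KA p q - KA p' q'| <= e.
Hypotheses (hE : (h : R -> R) = ind x (x + d)) (fE : (f : R -> R) = ind y (y + d)).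

Let B0 : 0 <= B. Proof. exact: le_trans (tB 0 0). Qed.
Let e0 : 0 <= e.
Proof.
by apply: le_trans (te (p:=0) (p':=0) (q:=0) (q':=0) _ _);
  rewrite // subrr normr0 ltW.
Qed.
Let x0 : 0 <= x. Proof. by apply: le_trans yx; rewrite addr_ge0 // ltW. Qed.
Let yd1 : y + d <= 1. Proof. by apply: (le_trans yx); apply: le_trans x1; rewrite lerDl ltW. Qed.
Let mlow t := measurable_low t ct.
Let blow t s := norm_low t s tB.

Let Q := int01 (fun s => ind 0 y s * (tau y s * tau x s)).

Let approx_x c r (u : R -> R) : measurable_fun setT u -> itg01 u ->
  ae01 (fun t => x <= t -> t < x + d -> `|u t - c| <= r) ->
  `|int01 (fun t => ind x (x + d) t * u t) - d * c| <= d * r.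
Proof.
move=> mu iu ur.
have := int01_ind_approx (a := x) (b := x + d) x0 _ x1 mu iu ur.
by rewrite addrAC subrr add0r; apply; rewrite lerDl ltW.
Qed.

Let approx_y c r (u : R -> R) : measurable_fun setT u -> itg01 u ->
  ae01 (fun t => y <= t -> t < y + d -> `|u t - c| <= r) ->
  `|int01 (fun t => ind y (y + d) t * u t) - d * c| <= d * r.
Proof.
move=> mu iu ur.
have := int01_ind_approx (a := y) (b := y + d) y0 _ yd1 mu iu ur.
by rewrite addrAC subrr add0r; apply; rewrite lerDl ltW.
Qed.

(** For [s < y + d <= x <= t] the point [(t, s)] is below the diagonal, so the cut-off equals 1 and
    [low] may be replaced by [tau]. *)
Let approx_Tf : `|int01 (fun t => h t * T f t) - d * (d * tau x y)| <= d * (d * e).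
Proof.
rewrite hE; apply: approx_x; [exact: L2_measurable|exact: L2_itg01|].
apply: ae01_imp (lf_T lf f) => t t01 -> xt tx.
rewrite (_ : int01 _ = int01 (fun s => ind y (y + d) s * low tau t s)); last first.
  by apply: eq_int01 => s _; rewrite fE mulrC.
apply: approx_y => //; first exact: (itg01_bounded (C := B)).
apply/aeW => s _ ys sy; rewrite /low (_ : (s <= t)%R) ?mul1r; last first.
  by rewrite (le_trans (ltW sy)) // (le_trans yx).
by apply: te; rewrite ler_norml; lra.
Qed.

(** By adjunction this is the pairing of [T h] with [f]. For [t < y + d <= x], the function
    [low tau t] vanishes on the support of [h]. *)
Let zero_g : int01 (fun t => h t * Tadj f t) = 0.
Proof.
rewrite -(lf_adj lf) -[RHS](@int01_cst R 0); apply: ae_eq_int01 => //.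
  by apply: measurable_funM; exact: L2_measurable.
apply: ae01_imp (lf_T lf h) => t t01 ->; rewrite fE /ind.
case: andP => [[yt ty]|_]; last by rewrite mulr0.
rewrite (_ : int01 _ = 0) ?mul0r // -[RHS](@int01_cst R 0).
apply: eq_int01 => s _; rewrite hE /ind /low.
case: andP => [[xs sx]|_]; last by rewrite mulr0.
by rewrite leNgt (lt_le_trans ty) ?mul0r // (le_trans yx).
Qed.

(** A bound for the change of [low tau t s] when [t], in [x, x+d[, is moved to [x]: at most [e] by
    continuity for [s <= x], and at most [B] on the strip beyond [x], where the cut-off itself
    changes. *)
Let w (s : R) : R := e + B * ind x (x + d) s.

Let w_ge0 s : 0 <= w s.
Proof. by rewrite /w addr_ge0 // mulr_ge0 // ind_ge0. Qed.

Let w_le s : w s <= e + B.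
Proof.
rewrite /w lerD2l -[leRHS]mulr1 ler_wpM2l //.
by apply: le_trans (norm_ind x (x + d) s); exact: ler_norm.
Qed.

Let mw : measurable_fun setT w.
Proof.
apply: measurable_funD => //; apply: measurable_funM => //.
exact: measurable_ind.
Qed.

Let g := Tadj f.

(* Apply the adjoint relation to [w * sgn g]; [w] equals [e] on the values of [s]
   that [low tau t], [t < y + d], can see. *)
Let int_w_g : int01 (fun s => w s * `|g s|) <= d * (B * e).
Proof.
pose u0 (s : R) : R := w s * Num.sg (g s).
have mu0 : measurable_fun setT u0.
  apply: measurable_funM => //.
  by apply: measurableT_comp; [exact: measurable_sgr|exact: L2_measurable].
have bu0 s : `|u0 s| <= e + B.
  rewrite /u0 normrM ger0_norm // -[leRHS]mulr1 ler_pM //.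
  by rewrite normr_sg; case: (_ != 0).
have [u uE] := L2_of_bounded mu0 bu0.
have -> : int01 (fun s => w s * `|g s|) = int01 (fun t => ind y (y + d) t * T u t).
  rewrite -fE; under [RHS]eq_int01 do rewrite mulrC.
  rewrite (lf_adj lf) uE; apply: eq_int01 => s _.
  by rewrite /u0 -mulrA -normrEsg.
apply: le_trans (ler_norm _) _; rewrite -[int01 _]subr0 -{1}(mulr0 d).
apply: approx_y; [exact: L2_measurable|exact: L2_itg01|].
apply: ae01_imp (lf_T lf u) => t t01 -> yt ty; rewrite subr0.
rewrite -[B * e]int01_cst; apply: norm_int01_le.
- by apply: measurable_funM => //; exact: L2_measurable.
- exact: itg01_L2_mul.
- by [].
- exact: itg01_cst.
- apply/aeW => s _; rewrite normrM uE /u0.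
  rewrite /low; case: (leP s t) => [st|ts]; last first.
    by rewrite mul0r normr0 mul0r mulr_ge0.
  rewrite mul1r ler_pM // normrM ger0_norm // -[leRHS]mulr1 ler_pM //.
    rewrite /w /ind (_ : (x <= s)%R = false) /= ?mulr0 ?addr0 //.
    by apply/negbTE; rewrite -ltNge (le_lt_trans st) // (lt_le_trans ty).
  by rewrite normr_sg; case: (_ != 0).
Qed.

(** [T g] has no reliable value at the single point [x]; the integral against [low tau x] takes its
    place. The error is at most the integral of [w] times the modulus of [g], hence of order [d]. *)
Let approx_Tg : `|int01 (fun t => h t * T g t)
  - d * int01 (fun s => low tau x s * g s)| <= d * (d * (B * e)).
Proof.
rewrite hE; apply: approx_x; [exact: L2_measurable|exact: L2_itg01|].
apply: ae01_imp (lf_T lf g) => t t01 -> xt tx.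
have ilow r : itg01 (fun s => low tau r s * g s) by exact: itg01_L2_mul.
rewrite -int01B //.
have mlowg r : measurable_fun setT (fun s => low tau r s * g s).
  by apply: measurable_funM => //; exact: L2_measurable.
apply: le_trans int_w_g; apply: norm_int01_le.
- exact: measurable_funB.
- have -> : (fun s => low tau t s * g s - low tau x s * g s) =
      (fun s => (low tau t s - low tau x s) * g s).
    by apply/funext => s; rewrite mulrBl.
  apply: (itg01_L2_mul (C := B + B)); first exact: measurable_funB.
  by move=> s; apply: (le_trans (ler_normB _ _)); rewrite lerD.
- apply: measurable_funM => //; apply: measurableT_comp => //.
  exact: L2_measurable.
- have -> : (fun s => w s * `|g s|) = (fun s => `|w s * g s|).
    by apply/funext => s; rewrite normrM ger0_norm.
  by apply: itg01_norm; apply: (itg01_L2_mul (C := e + B)) => // s; rewrite ger0_norm.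
apply/aeW => s _; rewrite -mulrBl normrM ler_wpM2r //.
rewrite /low /w /ind; case: (leP s t) => [st|ts]; last first.
  by rewrite (lt_geF (le_lt_trans xt ts)) /= !mul0r subrr normr0 addr_ge0 // mulr_ge0.
rewrite mul1r; case: (leP s x) => [sx|xs].
  rewrite mul1r; apply: (@le_trans _ _ e).
    by apply: te; [rewrite ler_norml; lra|rewrite subrr normr0 ltW].
  by rewrite lerDl mulr_ge0.
rewrite mul0r subr0 (ltW xs) (le_lt_trans st tx) mulr1.
by apply: (le_trans (tB _ _)); rewrite lerDr.
Qed.

Let approx_kg : `|int01 (fun s => low tau x s * g s) - d * Q|
  <= d * (e * B + B * B * d).
Proof.
(* The slice [low tau x] is itself an element [k] of L^2, so the adjoint relation replaces the
   unknown [g] by the explicit [T k], tested against [f]. *)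
have [k kE] := L2_of_bounded (mlow x) (blow x).
have -> : int01 (fun s => low tau x s * g s) =
    int01 (fun t => ind y (y + d) t * T k t).
  by rewrite -fE -kE -(lf_adj lf); apply: eq_int01 => s _; rewrite mulrC.
apply: approx_y; [exact: L2_measurable|exact: L2_itg01|].
apply: ae01_imp (lf_T lf k) => t t01 -> yt ty.
have mt r : measurable_fun setT (tau r) by exact: measurable_slice.
have mQ : measurable_fun setT (fun s => ind 0 y s * (tau y s * tau x s)).
  by apply: measurable_funM; [exact: measurable_ind|exact: measurable_funM].
have BB a b : `|a| <= B -> `|b| <= B -> `|a * b| <= B * B.
  by move=> aB bB; rewrite normrM ler_pM.
have iQ : itg01 (fun s => ind 0 y s * (tau y s * tau x s)).
  apply: itg01_ind_mul; first exact: measurable_funM.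
  apply: (itg01_bounded (C := B * B)); first exact: measurable_funM.
  by move=> s; exact: BB.
have mL : measurable_fun setT (fun s => low tau t s * low tau x s).
  exact: measurable_funM.
have iL : itg01 (fun s => low tau t s * low tau x s).
  by apply: (itg01_bounded (C := B * B)) => // s; exact: BB.
rewrite kE /Q -int01B //.
(* The error splits at [y]. For [s < y], moving [t] to [y] costs [e * B]; for [s] between [y] and
   [t] a product of size at most [B * B] is left over, on a set inside [y, y+d[. *)
have -> : e * B + B * B * d = int01 (fun s => e * B + B * B * ind y (y + d) s).
  rewrite int01D; [|exact: itg01_cst|exact/itg01Z/itg01_ind].
  rewrite int01_cst int01Z ?int01_ind //; [|by rewrite lerDl ltW|exact: itg01_ind].
  by rewrite (addrAC y) subrr add0r.
apply: norm_int01_le.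
- exact: measurable_funB.
- apply: (itg01_bounded (C := B * B + B * B)); first exact: measurable_funB.
  move=> s; apply: (le_trans (ler_normB _ _)); apply: lerD; first exact: BB.
  rewrite normrM -[leRHS]mul1r; apply: ler_pM => //; first exact: norm_ind.
  exact: BB.
- apply: measurable_funD => //; apply: measurable_funM => //.
  exact: measurable_ind.
- by apply: itg01D; [exact: itg01_cst|exact/itg01Z/itg01_ind].
rewrite /ae01; apply/aeW => s /andP[s0 s1].
have tx : t <= x by rewrite (le_trans (ltW ty)).
rewrite /low /ind s0 /=; case: (ltP s y) => [sy|ys] /=.
  rewrite (le_trans (ltW sy) yt) (le_trans (ltW sy) (le_trans yt tx)) !mul1r.
  rewrite mulr0 addr0 -mulrBl normrM ler_pM //.
  by apply: te; [rewrite ler_norml; lra|rewrite subrr normr0 ltW].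
rewrite mul0r subr0; case: (leP s t) => [st|ts]; last first.
  by rewrite mul0r mul0r normr0 addr_ge0 ?mulr_ge0 // ler0n.
rewrite (le_trans st tx) (le_lt_trans st ty) !mul1r mulr1.
by apply: (le_trans (BB _ _ (tB _ _) (tB _ _))); rewrite lerDr mulr_ge0.
Qed.

Let est_rhs : `|int01 (fun t => h t * A f t) - d * (d * (tau x y + Q))|
  <= d * (d * (e + 2 * (B * e) + B * B * d)).
Proof.
have iL2 (u : R -> R) (C : R) (v : L2 R) : measurable_fun setT u ->
    (forall s, `|u s| <= C) -> itg01 (fun t => u t * v t) by exact: itg01_L2_mul.
have mh : measurable_fun setT (h : R -> R) by exact: L2_measurable.
have bh s : `|h s| <= 1 by rewrite hE norm_ind.
have -> : int01 (fun t => h t * A f t) = int01 (fun t => h t * g t)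
    + int01 (fun t => h t * T f t) + int01 (fun t => h t * T g t).
  rewrite -int01D; [|exact: iL2 mh bh|exact: iL2 mh bh].
  rewrite -int01D; [|apply: itg01D; exact: iL2 mh bh|exact: iL2 mh bh].
  apply: ae_eq_int01.
  - by apply: measurable_funM; exact: L2_measurable.
  - by do ![apply: measurable_funD]; apply: measurable_funM; exact: L2_measurable.
  - by apply: ae01_imp (lf_dec lf f) => t _ ->; rewrite !mulrDr.
rewrite zero_g add0r.
have := approx_Tf; have := approx_Tg; have := approx_kg.
set a := int01 _; set b := int01 _; set c := int01 _ => h1 h2 h3.
have {h1} h1 : `|d * (a - d * Q)| <= d * (d * (e * B + B * B * d)).
  by rewrite normrM gtr0_norm // ler_pM2l.
move: h1 h2 h3; rewrite !ler_norml => /andP[? ?] /andP[? ?] /andP[? ?].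
apply/andP; split; lra.
Qed.

Let est_lhs : `|int01 (fun t => h t * A f t) - d * (d * KA x y)| <= d * (d * e).
Proof.
rewrite hE; apply: approx_x; [exact: L2_measurable|exact: L2_itg01|].
apply: ae01_imp (lf_A lf f) => t t01 -> xt tx.
rewrite (_ : int01 _ = int01 (fun s => ind y (y + d) s * KA t s)); last first.
  by apply: eq_int01 => s _; rewrite fE mulrC.
have [[C CA] _] := cA.
have mA : measurable_fun setT (KA t) by exact: measurable_slice.
apply: approx_y => //; first exact: (itg01_bounded (C := C)).
by apply/aeW => s _ ys sy; apply: Ae; rewrite ler_norml; lra.
Qed.

Let est_lhs' : `|int01 (fun t => f t * A h t) - d * (d * KA y x)| <= d * (d * e).
Proof.
rewrite fE; apply: approx_y; [exact: L2_measurable|exact: L2_itg01|].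
apply: ae01_imp (lf_A lf h) => t t01 -> xt tx.
rewrite (_ : int01 _ = int01 (fun s => ind x (x + d) s * KA t s)); last first.
  by apply: eq_int01 => s _; rewrite hE mulrC.
have [[C CA] _] := cA.
have mA : measurable_fun setT (KA t) by exact: measurable_slice.
apply: approx_x => //; first exact: (itg01_bounded (C := C)).
by apply/aeW => s _ ys sy; apply: Ae; rewrite ler_norml; lra.
Qed.

(** The sum of [Tadj] and [T], and the composite of [T] after [Tadj], are symmetric for the pairing.
    Hence the value [KA y x] above the diagonal is reached from the estimates already made, without
    a second analysis for the opposite order of supports. *)
Let self_adj : int01 (fun t => f t * A h t) = int01 (fun t => h t * A f t).
Proof.
have iL2 (u : R -> R) (C : R) (v : L2 R) : measurable_fun setT u ->
    (forall s, `|u s| <= C) -> itg01 (fun t => u t * v t) by exact: itg01_L2_mul.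
have E (u v : L2 R) : (forall s, `|u s| <= 1) ->
    int01 (fun t => u t * A v t) = int01 (fun t => u t * Tadj v t)
    + int01 (fun t => u t * T v t) + int01 (fun t => u t * T (Tadj v) t).
  move=> bu; have mu : measurable_fun setT (u : R -> R) by exact: L2_measurable.
  rewrite -int01D; [|exact: iL2 mu bu|exact: iL2 mu bu].
  rewrite -int01D; [|apply: itg01D; exact: iL2 mu bu|exact: iL2 mu bu].
  apply: ae_eq_int01.
  - by apply: measurable_funM; exact: L2_measurable.
  - by do ![apply: measurable_funD]; apply: measurable_funM; exact: L2_measurable.
  - by apply: ae01_imp (lf_dec lf v) => t _ ->; rewrite !mulrDr.
have C (u v : L2 R) : int01 (fun t => u t * v t) = int01 (fun t => v t * u t).
  by apply: eq_int01 => t _; rewrite mulrC.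
rewrite (E f h) => [|s]; last by rewrite fE norm_ind.
rewrite (E h f) => [|s]; last by rewrite hE norm_ind.
rewrite -!(lf_adj lf) (C f (T h)) (C h (T f)) (C f (T (Tadj h))).
rewrite (C h (T (Tadj f))) !(lf_adj lf) (C (Tadj h)).
by congr (_ + _); rewrite addrC.
Qed.

(** Both kernel values, times [d * d], approximate the same pairing; the bound adds the error [e] of
    the left side to [e + 2 * (B * e) + B * B * d] of the right side and divides by [d * d]. *)
Lemma main_estimate : let E := 2 * e + 2 * (B * e) + B * B * d in
  `|KA x y - (tau x y + Q)| <= E /\ `|KA y x - (tau x y + Q)| <= E.
Proof.
have dd : 0 < d * d by rewrite mulr_gt0.
have h1 := est_rhs; have h2 := est_lhs; have h3 := est_lhs'.
rewrite self_adj in h3; move: h1 h2 h3; set a := int01 _.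
move=> h1 h2 h3; split; rewrite -(ler_pM2l dd).
  rewrite -[X in X * `|_|](gtr0_norm dd) -normrM.
  move: h1 h2; rewrite !ler_norml => /andP[? ?] /andP[? ?].
  apply/andP; split; lra.
rewrite -[X in X * `|_|](gtr0_norm dd) -normrM.
move: h1 h3; rewrite !ler_norml => /andP[? ?] /andP[? ?].
apply/andP; split; lra.
Qed.

End main_estimate.

Lemma eq_of_dist_le (R : realType) (a b : R) :
  (forall e : R, 0 < e -> `|a - b| <= e) -> a = b.
Proof.
move=> H; apply/eqP; rewrite -subr_eq0 -normr_le0; apply/ler_addgt0Pr => e e0.
by rewrite add0r H.
Qed.

Lemma dist_int01_le (R : realType) (u v : R -> R) (C D e : R) :
  measurable_fun setT u -> (forall t, `|u t| <= C) ->
  measurable_fun setT v -> (forall t, `|v t| <= D) ->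
  (forall t, 0 <= t <= 1 -> `|u t - v t| <= e) -> `|int01 u - int01 v| <= e.
Proof.
move=> mu uC mv vD uv.
have iu := itg01_bounded mu uC; have iv := itg01_bounded mv vD.
rewrite -int01B // -[leRHS]int01_cst; apply: norm_int01_le => //.
- exact: measurable_funB.
- apply: (itg01_bounded (C := C + D)); first exact: measurable_funB.
  by move=> t; apply: (le_trans (ler_normB _ _)); rewrite lerD.
- exact: itg01_cst.
- exact/aeW.
Qed.

(** On [y <= x], the kernel of the product of [1 + T] and its adjoint, minus the identity: the inner
    integral stops at the smaller variable [y]. *)
Definition gram (R : realType) (tau : R -> R -> R) (x y : R) : R :=
  tau x y + int01 (fun s => ind 0 y s * (tau y s * tau x s)).

Lemma kernel_identity (R : realType) (KA tau : R -> R -> R)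
    (A T Tadj : L2 R -> L2 R) :
  bdd_ucont2 tau -> bdd_ucont2 KA -> lower_factor KA tau A T Tadj ->
  forall x y, 0 <= y -> y <= x -> x < 1 ->
  KA x y = gram tau x y /\ KA y x = gram tau x y.
Proof.
move=> ct cA lf x y y0 yx x1.
have [[B tB] uct] := ct; have [_ ucA] := cA.
have B0 : 0 <= B by apply: le_trans (tB 0 0).
suff H (eps : R) : 0 < eps -> `|KA x y - gram tau x y| <= eps /\
    `|KA y x - gram tau x y| <= eps.
  by split; apply: eq_of_dist_le => eps /H[].
move=> eps0.
(* The coefficient of [e] in the total error once [d <= e]: [2 + 2 * B + B * B] from
   [main_estimate], and [2 + B] from moving [x + d] back to [x] in [tau], [KA] and the integral. *)
pose M := 4 + 3 * B + B * B.
have M0 : 0 < M by rewrite /M !ltr_wpDr ?mulr_ge0.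
pose e := eps / M.
have e0 : 0 < e by rewrite divr_gt0.
have [dt dt0 Ht] := uct e e0; have [da da0 Ha] := ucA e e0.
pose d := Num.min (Num.min (dt / 2) (da / 2)) (Num.min e ((1 - x) / 2)).
have d0 : 0 < d by rewrite !lt_min !divr_gt0 ?subr_gt0 // e0.
have /andP[/andP[ddt dda] /andP[de d1]] :
    (d <= dt / 2) && (d <= da / 2) && ((d <= e) && (d <= (1 - x) / 2)).
  by rewrite -!le_min.
have te p p' q q' : `|p - p'| <= d -> `|q - q'| <= d ->
    `|tau p q - tau p' q'| <= e.
  by move=> h1 h2; apply: Ht; [apply: le_lt_trans h1 _|apply: le_lt_trans h2 _]; lra.
have Ae p p' q q' : `|p - p'| <= d -> `|q - q'| <= d ->
    `|KA p q - KA p' q'| <= e.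
  by move=> h1 h2; apply: Ha; [apply: le_lt_trans h1 _|apply: le_lt_trans h2 _]; lra.
(* The first interval starts at [x + d] and not at [x], so that the supports are ordered even when
   [y = x]; it ends at [x + 2 d], which [d <= (1 - x) / 2] keeps inside [0,1]. *)
have [h hE] := L2_of_bounded (@measurable_ind R (x + d) (x + d + d)) (@norm_ind R _ _).
have [f fE] := L2_of_bounded (@measurable_ind R y (y + d)) (@norm_ind R _ _).
have [] := main_estimate ct tB cA lf y0 d0 _ _ te Ae hE fE.
- by rewrite lerD2r.
- by lra.
have x01 : 0 <= x by exact: le_trans yx.
have xdx : `|x + d - x| <= d by rewrite addrAC subrr add0r gtr0_norm.
have zz (z : R) : `|z - z| <= d by rewrite subrr normr0 ltW.
have mt r : measurable_fun setT (tau r) by exact: measurable_slice.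
have mQ r : measurable_fun setT (fun s => ind 0 y s * (tau y s * tau r s)).
  by apply: measurable_funM; [exact: measurable_ind|exact: measurable_funM].
have bQ r s : `|ind 0 y s * (tau y s * tau r s)| <= B * B.
  rewrite normrM -[leRHS]mul1r ler_pM ?norm_ind //.
  by rewrite normrM ler_pM.
set Q' := int01 _ => h1 h2.
have h3 : `|Q' - int01 (fun s => ind 0 y s * (tau y s * tau x s))| <= B * e.
  apply: dist_int01_le (mQ _) (bQ _) (mQ _) (bQ _) _ => s _.
  rewrite -!mulrBr !normrM -[leRHS]mul1r ler_pM ?norm_ind ?mulr_ge0 //.
  by rewrite ler_pM //; exact: te.
have h4 := te _ _ _ _ xdx (zz y).
have h5 := Ae _ _ _ _ xdx (zz y).
have h6 := Ae _ _ _ _ (zz y) xdx.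
have bound : 2 * e + 2 * (B * e) + B * B * d + e + e + B * e <= eps.
  have -> : eps = e * M by rewrite /e divfK // gt_eqF.
  have : B * B * d <= B * B * e by rewrite ler_wpM2l ?mulr_ge0.
  rewrite /M; lra.
rewrite /gram; move: h1 h2 h3 h4 h5 h6; rewrite !ler_norml.
move=> /andP[? ?] /andP[? ?] /andP[? ?] /andP[? ?] /andP[? ?] /andP[? ?].
split; apply/andP; split; lra.
Qed.

(** * Riemann sums and the discrete triangular factor *)

(** Allows any grid point [k/n] as upper end, because the integral in [gram] stops at [y]; each cell
    adds [e / n] to the error. *)
Lemma riemann_ind (R : realType) (u : R -> R) (C e : R) (n k : nat) :
  measurable_fun setT u -> (forall x, `|u x| <= C) -> (k <= n)%N ->
  (forall x y, `|x - y| <= n%:R^-1 -> `|u x - u y| <= e) ->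
  `|int01 (fun s => ind 0 (k%:R / n%:R) s * u s)
    - n%:R^-1 * \sum_(j < k) u (j%:R / n%:R)| <= k%:R / n%:R * e.
Proof.
move=> mu uC kn ue; have iu := itg01_bounded mu uC.
elim: k kn => [_|k IH kn].
  rewrite big_ord0 mulr0 subr0 mul0r mul0r (_ : int01 _ = 0) ?normr0 //.
  rewrite -[RHS](@int01_cst R 0); apply: eq_int01 => s /andP[s0 _].
  by rewrite /ind ltNge s0 mul0r.
have n0 : 0 < n%:R :> R by rewrite ltr0n (leq_ltn_trans _ kn).
have n1 : 0 < n%:R^-1 :> R by rewrite invr_gt0.
have kE : k.+1%:R / n%:R = k%:R / n%:R + n%:R^-1 :> R.
  by rewrite -natr1 mulrDl mul1r.
set a : R := k%:R / n%:R in kE *.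
have a0 : 0 <= a by rewrite divr_ge0 // ltW.
have an : a + n%:R^-1 <= 1.
  by rewrite -kE ler_pdivrMr // mul1r ler_nat.
have iind b c : itg01 (fun s => ind b c s * u s) by exact: itg01_ind_mul.
rewrite kE.
have -> : int01 (fun s => ind 0 (a + n%:R^-1) s * u s)
    = int01 (fun s => ind 0 a s * u s) + int01 (fun s => ind a (a + n%:R^-1) s * u s).
  rewrite -int01D //; apply: eq_int01 => s /andP[s0 s1].
  rewrite -mulrDl; congr (_ * _); rewrite /ind s0 /=.
  case: (ltP s a) => sa /=; last by rewrite add0r.
  by rewrite addr0 (lt_le_trans sa) // lerDl ltW.
rewrite big_ord_recr /= -/a mulrDr mulrDl opprD addrACA.
apply: (le_trans (ler_normD _ _)); apply: lerD; first by apply: IH; exact: ltnW.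
have := @int01_ind_approx R a (a + n%:R^-1) (u a) e u a0 _ an mu iu.
rewrite (addrAC a) subrr add0r; apply; first by rewrite lerDl ltW.
apply/aeW => x _ ax xa; apply: ue; rewrite ger0_norm ?subr_ge0 // lerBlDl ltW //.
Qed.

Lemma int01_ind01 (R : realType) (u : R -> R) :
  measurable_fun setT u -> int01 (fun s => ind 0 1 s * u s) = int01 u.
Proof.
move=> mu; apply: ae_eq_int01 => //.
  by apply: measurable_funM => //; exact: measurable_ind.
exists [set 1]; split => //; first by rewrite /= lebesgue_measure_set1.
move=> s /= h; apply: contrapT => s1; apply: h => /andP[s0 sle1].
by rewrite /ind s0 lt_neqAle sle1 andbT (_ : s != 1) ?mul1r //; apply/eqP.
Qed.

Lemma riemann01 (R : realType) (u : R -> R) (C e : R) (n : nat) :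
  measurable_fun setT u -> (forall x, `|u x| <= C) -> (0 < n)%N ->
  (forall x y, `|x - y| <= n%:R^-1 -> `|u x - u y| <= e) ->
  `|int01 u - n%:R^-1 * \sum_(j < n) u (j%:R / n%:R)| <= e.
Proof.
move=> mu uC n0 ue; have := riemann_ind mu uC (leqnn n) ue.
by rewrite divff ?int01_ind01 ?mul1r // pnatr_eq0 -lt0n.
Qed.

(* The diagonal is chosen so that its square is [1 + tau (t, t) / n + O(1/n^2)]. *)
Definition chol (R : realType) (tau : R -> R -> R) (n : nat) : 'M[R]_n :=
  \matrix_(i, j) (if i == j then 1 + tau (i%:R / n%:R) (i%:R / n%:R) / (2 * n%:R)
     else if (j < i)%N then tau (i%:R / n%:R) (j%:R / n%:R) / n%:R else 0).

Lemma det_chol (R : realType) (tau : R -> R -> R) (n : nat) :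
  \det (chol tau n)
  = \prod_(i < n) (1 + tau (i%:R / n%:R) (i%:R / n%:R) / (2 * n%:R)).
Proof.
rewrite det_trig; first by apply: eq_bigr => i _; rewrite mxE eqxx.
apply/is_trig_mxP => i j ij; rewrite mxE -val_eqE /= (ltn_eqF ij).
by rewrite ltnNge (ltnW ij).
Qed.

(** In the product of rows [i] and [k], the columns [j < k] give the Riemann sum and those beyond
    [k] vanish. Column [k] leaves a remainder with denominator [2 n] off the diagonal and, from
    squaring [1 + tau / (2 n)], [4 n] on it; the boolean merges the two cases. *)
Lemma chol_gramE (R : realType) (tau : R -> R -> R) (n : nat) (i k : 'I_n) :
  (k <= i)%N -> let t (j : nat) : R := j%:R / n%:R in
  (chol tau n *m (chol tau n)^T) i k = (i == k)%:R + n%:R^-1 * (tau (t i) (t k)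
    + n%:R^-1 * \sum_(j < k) (tau (t k) (t j) * tau (t i) (t j))
    + tau (t i) (t k) * tau (t k) (t k) / ((2 + 2 * (i == k)%:R) * n%:R)).
Proof.
move=> ki t; rewrite mxE.
under eq_bigr do rewrite !mxE.
have n0 : n%:R != 0 :> R.
  by rewrite pnatr_eq0 -lt0n; case: (n) i {ki} => [[]|].
rewrite (bigID (fun j : 'I_n => (j < k)%N)) /= [X in _ + X](bigD1 k) /= ?ltnn //.
rewrite [X in _ + (_ + X)]big1 ?addr0; last first.
  move=> j /andP[]; rewrite -leqNgt => kj jk.
  by rewrite [k == j]eq_sym (negPf jk) [(j < k)%N]ltnNge kj mulr0.
rewrite !eqxx.
have -> : \sum_(j < n | (j < k)%N)
   (if i == j then 1 + tau (i%:R / n%:R) (i%:R / n%:R) / (2 * n%:R)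
     else if (j < i)%N then tau (i%:R / n%:R) (j%:R / n%:R) / n%:R else 0) *
   (if k == j then 1 + tau (k%:R / n%:R) (k%:R / n%:R) / (2 * n%:R)
     else if (j < k)%N then tau (k%:R / n%:R) (j%:R / n%:R) / n%:R else 0)
  = n%:R^-1 * (n%:R^-1 * \sum_(j < k) (tau (t k) (t j) * tau (t i) (t j))).
  rewrite mulrA big_distrr /= (big_ord_widen n (fun j =>
    n%:R^-1 * n%:R^-1 * (tau (t k) (t j) * tau (t i) (t j))) (ltnW (ltn_ord k))).
  apply: eq_bigr => j jk.
  rewrite -!val_eqE /= !gtn_eqF ?jk ?(leq_trans jk) // /t; ring.
case: (eqVneq i k) => [->|ik]; first by rewrite /t /=; field.
have -> : (k < i)%N by rewrite ltn_neqAle ki andbT eq_sym -val_eqE in ik *.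
by rewrite /t /=; field.
Qed.

Lemma inv_nat_small (R : realType) (d : R) : 0 < d ->
  exists N : nat, forall n, (N <= n)%N -> (0 < n)%N /\ n%:R^-1 < d.
Proof.
move=> d0; have di : 0 < d^-1 by rewrite invr_gt0.
exists (Num.bound d^-1) => n Nn.
have dn : d^-1 < n%:R.
  by apply: lt_le_trans (_ : (Num.bound d^-1)%:R <= _);
    [exact: archi_boundP (ltW di)|rewrite ler_nat].
have n0 : (0 < n)%N by rewrite -(ltr_nat R); exact: lt_trans dn.
by split => //; rewrite -[ltRHS]invrK ltf_pV2 // posrE ltr0n.
Qed.

Definition chol_defect (R : realType) (tau : R -> R -> R) (n : nat) : 'M[R]_n :=
  n%:R *: (chol tau n *m (chol tau n)^T - 1%:M).

Lemma chol_defect_det (R : realType) (tau : R -> R -> R) (n : nat) :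
  (0 < n)%N -> \det (1%:M + n%:R^-1 *: chol_defect tau n) = \det (chol tau n) ^+ 2.
Proof.
move=> n0; rewrite /chol_defect scalerA mulVf ?pnatr_eq0 -?lt0n // scale1r.
by rewrite addrC subrK det_mulmx det_tr expr2.
Qed.

Lemma chol_approx (R : realType) (KA tau : R -> R -> R) :
  bdd_ucont2 tau ->
  (forall x y, 0 <= y -> y <= x -> x < 1 ->
    KA x y = gram tau x y /\ KA y x = gram tau x y) ->
  forall e : R, 0 < e -> exists N : nat, forall n, (N <= n)%N -> forall i j : 'I_n,
    `|chol_defect tau n i j - KA (i%:R / n%:R) (j%:R / n%:R)| <= e.
Proof.
move=> ct HK e e0; have [[B tB] uct] := ct.
have B0 : 0 <= B by apply: le_trans (tB 0 0).
(* Half of [e] goes to the Riemann sum: a product of two values of [tau] varies by at most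
   [2 * B * e'] over a cell. The other half absorbs the remainder of order [B * B / n]. The added 1
   keeps both denominators positive when [B = 0]. *)
pose e' := e / (2 * (2 * B + 1)).
have B21 : 0 < 2 * B + 1 by rewrite ltr_wpDl ?mulr_ge0.
have e'0 : 0 < e' by rewrite divr_gt0 // mulr_gt0.
have [d d0 Hd] := uct e' e'0.
have [N1 H1] := inv_nat_small d0.
have e2 : 0 < e / (2 * (B * B + 1)) by rewrite divr_gt0 // mulr_gt0 // ltr_wpDl ?mulr_ge0.
have [N2 H2] := inv_nat_small e2.
exists (maxn N1 N2) => n; rewrite geq_max => /andP[/H1[n0 nd] /H2[_ ne]].
have nn0 : n%:R != 0 :> R by rewrite pnatr_eq0 -lt0n.
have np : 0 < n%:R :> R by rewrite ltr0n.
(* The other triangle follows from the symmetry of [chol_defect] and the second half of the kernel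
   identity. *)
suff main (i k : 'I_n) : (k <= i)%N ->
    `|chol_defect tau n i k - gram tau (i%:R / n%:R) (k%:R / n%:R)| <= e.
  have t0 (i : 'I_n) : 0 <= i%:R / n%:R :> R by rewrite divr_ge0 // ltW.
  have t1 (i : 'I_n) : i%:R / n%:R < 1 :> R by rewrite ltr_pdivrMr // mul1r ltr_nat.
  have tm (i j : 'I_n) : (i <= j)%N -> i%:R / n%:R <= j%:R / n%:R :> R.
    by move=> ij; rewrite ler_pM2r ?invr_gt0 // ler_nat.
  move=> i j; case: (leqP j i) => ij.
    by have [-> _] := HK _ _ (t0 j) (tm _ _ ij) (t1 i); exact: main.
  have [_ ->] := HK _ _ (t0 i) (tm _ _ (ltnW ij)) (t1 j).
  have -> : chol_defect tau n i j = chol_defect tau n j i.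
    have : (chol_defect tau n)^T = chol_defect tau n.
      by rewrite /chol_defect linearZ /= raddfB /= trmx_mul trmxK trmx1.
    by move=> E; rewrite -{1}E mxE.
  exact: main (ltnW ij).
move=> ki.
pose t (j : nat) : R := j%:R / n%:R.
have -> : chol_defect tau n i k = tau (t i) (t k)
    + n%:R^-1 * \sum_(j < k) (tau (t k) (t j) * tau (t i) (t j))
    + tau (t i) (t k) * tau (t k) (t k) / ((2 + 2 * (i == k)%:R) * n%:R).
  rewrite /chol_defect mxE [X in _ * X]mxE [X in _ + X]mxE [X in - X]mxE.
  by rewrite (chol_gramE _ ki) addrAC subrr add0r mulVKf.
rewrite /gram -/(t i) -/(t k).
have mt r : measurable_fun setT (tau r) by exact: measurable_slice.
have BB a b : `|a| <= B -> `|b| <= B -> `|a * b| <= B * B.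
  by move=> aB bB; rewrite normrM ler_pM.
have h1 := @riemann_ind R (fun s => tau (t k) s * tau (t i) s) (B * B)
  (2 * (B * e')) n k (measurable_funM (mt _) (mt _)) (fun s => BB _ _ (tB _ _) (tB _ _))
  (ltnW (ltn_ord k)).
have {}h1 := le_trans (h1 _) (_ : _ <= 2 * (B * e')).
have h2 : `|tau (t i) (t k) * tau (t k) (t k) / ((2 + 2 * (i == k)%:R) * n%:R)|
   <= e / 2.
  rewrite normrM normfV; apply: (@le_trans _ _ (B * B / n%:R)).
    apply: ler_pM => //; first exact: BB.
    rewrite lef_pV2 ?posrE //; last by rewrite normr_gt0 mulf_neq0 // lt0r_neq0 // ltr_wpDr.
    rewrite normrM (gtr0_norm np) -[leLHS]mul1r ler_pM2r //.
    by case: (i == k); rewrite /= ?mulr1n ?mulr0n ?mulr1 ?mulr0 ger0_norm; lra.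
  apply: (@le_trans _ _ ((B * B + 1) * (e / (2 * (B * B + 1))))).
    by apply: ler_pM; rewrite ?mulr_ge0 ?invr_ge0 ?(ltW ne) ?lerDl // ltW.
  have : B * B + 1 != 0 by rewrite gt_eqF // ltr_wpDl ?mulr_ge0.
  move=> ?; rewrite le_eqVlt; apply/orP; left; apply/eqP; by field.
have h3 : 2 * (B * e') <= e / 2.
  have -> : 2 * (B * e') = (2 * B) / (2 * B + 1) * (e / 2).
    by rewrite /e'; field; rewrite gt_eqF.
  apply: ler_piMl; first by rewrite divr_ge0 ?ltW.
  by rewrite ler_pdivrMr // mul1r lerDl.
have {}h1 : `|int01 (fun s => ind 0 (t k) s * (tau (t k) s * tau (t i) s))
  - n%:R^-1 * \sum_(j < k) (tau (t k) (t j) * tau (t i) (t j))| <= 2 * (B * e').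
  apply: h1; last first.
    have kn : k%:R / n%:R <= 1 :> R by rewrite ler_pdivrMr // mul1r ler_nat ltnW.
    by apply: ler_piMl kn; apply: mulr_ge0 => //; apply: mulr_ge0 => //; exact: ltW.
  move=> p q pq.
  have m r : `|tau r p - tau r q| <= e'.
    by apply: Hd; [rewrite subrr normr0|exact: le_lt_trans pq _].
  rewrite -(subrKA (tau (t k) q * tau (t i) p)) -mulrBl -mulrBr.
  apply: (le_trans (ler_normD _ _)); rewrite !normrM mulr_natl mulr2n.
  by apply: lerD; [rewrite mulrC|]; apply: ler_pM.
move: h1 h2; set a := int01 _; set b := _ * \sum_(_ < _) _; set c := _ / _.
rewrite !ler_norml => /andP[? ?] /andP[? ?].
apply/andP; split; lra.
Qed.

(** * Lipschitz bounds for determinants, and Riemann sums of iterated integrals *)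

(** Factors are exchanged one at a time; [1 <= B] lets the bound [B ^+ k] for the remaining factors
    be absorbed into [B ^+ k.+1]. *)
Lemma prod_lip (R : realFieldType) (k : nat) (a b : 'I_k -> R) (B d : R) :
  1 <= B -> (forall i, `|a i| <= B) -> (forall i, `|b i| <= B) ->
  (forall i, `|a i - b i| <= d) ->
  `|\prod_i a i - \prod_i b i| <= k%:R * B ^+ k * d.
Proof.
move=> B1; have B0 : 0 <= B by apply: le_trans B1.
elim: k a b => [|k IH] a b aB bB ab.
  by rewrite !big_ord0 subrr normr0 mul0r mul0r.
have d0 : 0 <= d by apply: le_trans (ab ord0).
rewrite !big_ord_recl.
rewrite -(subrKA (b ord0 * \prod_(i < k) a (lift ord0 i))) -mulrBl -mulrBr.
apply: (le_trans (ler_normD _ _)); rewrite !normrM.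
have hp : `|\prod_(i < k) a (lift ord0 i)| <= B ^+ k.
  rewrite normr_prod -[in leRHS](card_ord k) -prodr_const.
  by apply: ler_prod => i _; rewrite normr_ge0 aB.
have hI := IH (a \o lift ord0) (b \o lift ord0) (fun i => aB _) (fun i => bB _)
  (fun i => ab _).
apply: (@le_trans _ _ (d * B ^+ k + B * (k%:R * B ^+ k * d))).
  by apply: lerD; apply: ler_pM.
have : B ^+ k <= B ^+ k.+1 by rewrite exprS ler_peMl // exprn_ge0.
move=> h; have := ler_wpM2l d0 h; rewrite exprS -natr1; lra.
Qed.

Lemma det_lip (R : realFieldType) (k : nat) (M N : 'M[R]_k) (B d : R) :
  1 <= B -> (forall i j, `|M i j| <= B) -> (forall i j, `|N i j| <= B) ->
  (forall i j, `|M i j - N i j| <= d) ->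
  `|\det M - \det N| <= k`!%:R * (k%:R * B ^+ k * d).
Proof.
move=> B1 MB NB MN; rewrite /determinant -sumrB.
apply: (le_trans (ler_norm_sum _ _ _)).
rewrite -card_Sn -sum1_card natr_sum mulr_suml /=.
under [leRHS]eq_bigl do rewrite inE.
apply: ler_sum => s _; rewrite -mulrBr normrM normrX normrN1 expr1n !mul1r.
exact: prod_lip.
Qed.

Definition bdd_ucontn (R : realType) (k : nat) (F : k.-tuple R -> R) :=
  (exists C, forall v, `|F v| <= C) /\
  (forall e, 0 < e -> exists2 d, 0 < d & forall u v,
    (forall i, `|tnth u i - tnth v i| < d) -> `|F u - F v| <= e).

Lemma bdd_ucontn_cons (R : realType) (k : nat) (F : k.+1.-tuple R -> R) (x : R) :
  bdd_ucontn F -> bdd_ucontn (fun v : k.-tuple R => F [tuple of x :: v]).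
Proof.
move=> [[C FC] uF]; split; first by exists C.
move=> e /uF[d d0 Fd]; exists d => // u v uv; apply: Fd => i.
case: (unliftP ord0 i) => [j ->|->]; first by rewrite !tnthS.
by rewrite !tnth0 subrr normr0.
Qed.

Lemma bdd_ucontn_det (R : realType) (K : R -> R -> R) (k : nat) :
  bdd_ucont2 K -> bdd_ucontn (fun x : k.-tuple R =>
    \det (\matrix_(p < k, q < k) K (tnth x p) (tnth x q))).
Proof.
move=> [[B KB] uK].
have B1 : 1 <= Num.max 1 B by rewrite le_max lexx.
have KB' (x y : R) : `|K x y| <= Num.max 1 B by rewrite le_max KB orbT.
split.
  (* Boundedness also comes from [det_lip], by comparison with the zero matrix. *)
  exists (k`!%:R * (k%:R * Num.max 1 B ^+ k * (Num.max 1 B + 0)) + `|\det (0 : 'M[R]_k)|) => v.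
  rewrite -lerBlDr (le_trans (lerB_dist _ _)) //.
  apply: det_lip => // i j; rewrite !mxE ?normr0 ?subr0 ?addr0 //.
  exact: le_trans B1.
move=> e e0; set c : R := k`!%:R * (k%:R * Num.max 1 B ^+ k).
have c0 : 0 <= c by rewrite !mulr_ge0 // exprn_ge0 // (le_trans _ B1).
have c1 : 0 < c + 1 by rewrite ltr_wpDl.
have [d d0 Kd] := uK (e / (c + 1)) (divr_gt0 e0 c1).
exists d => // u v uv.
apply: (@le_trans _ _ (k`!%:R * (k%:R * Num.max 1 B ^+ k * (e / (c + 1))))).
  by apply: det_lip => // i j; rewrite !mxE //; exact: Kd.
rewrite mulrA -/c mulrCA; apply: ler_piMr; first exact: ltW.
by rewrite ler_pdivrMr // mul1r lerDl ler01.
Qed.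

Lemma int01_iter (R : realType) (k : nat) (F : k.+1.-tuple R -> R) :
  iter_integral01 F
  = int01 (fun x => iter_integral01 (fun v : k.-tuple R => F [tuple of x :: v])).
Proof. by []. Qed.

(** The two parts are proved together: the second, for [k] variables, makes the inner integral
    uniformly continuous in the outer variable, hence measurable, and both parts need this at
    [k.+1]. *)
Lemma iter_integral_props (R : realType) (k : nat) (F : k.-tuple R -> R) :
  bdd_ucontn F ->
  (forall C : R, (forall v, `|F v| <= C) -> `|iter_integral01 F| <= C) /\
  (forall G (e : R), bdd_ucontn G -> (forall v, `|F v - G v| <= e) ->
    `|iter_integral01 F - iter_integral01 G| <= e).
Proof.
elim: k F => [|k IH] F cF; first by split => [C|G e _]; exact.
have bm (H : k.+1.-tuple R -> R) : bdd_ucontn H ->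
    measurable_fun setT (fun x => iter_integral01 (fun v : k.-tuple R => H [tuple of x :: v])).
  move=> cH; apply: ucont1_measurable => e e0.
  have [_ uH] := cH; have [d d0 Hd] := uH e e0.
  exists d => // x y xy; apply: (IH _ (bdd_ucontn_cons x cH)).2.
    exact: bdd_ucontn_cons.
  move=> v; apply: Hd => i.
  case: (unliftP ord0 i) => [j ->|->]; last by rewrite !tnth0.
  by rewrite !tnthS subrr normr0.
have bb (H : k.+1.-tuple R -> R) C : bdd_ucontn H -> (forall v, `|H v| <= C) ->
    forall x, `|iter_integral01 (fun v : k.-tuple R => H [tuple of x :: v])| <= C.
  by move=> cH HC x; apply: (IH _ (bdd_ucontn_cons x cH)).1.
split => [C FC|G e cG FG].
  rewrite int01_iter -[leRHS]int01_cst; apply: norm_int01_le.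
  - exact: bm.
  - exact: itg01_bounded (bm _ cF) (bb _ _ cF FC).
  - by [].
  - exact: itg01_cst.
  - by apply/aeW => x _; exact: bb.
have [[C FC] _] := cF; have [[D GD] _] := cG.
rewrite !int01_iter; apply: dist_int01_le (bm _ cF) (bb _ _ cF FC) (bm _ cG) (bb _ _ cG GD) _.
move=> x _; apply: (IH _ (bdd_ucontn_cons x cF)).2 => //.
exact: bdd_ucontn_cons.
Qed.

Lemma eq_iter_integral (R : realType) (k : nat) (F G : k.-tuple R -> R) :
  (forall v, (forall i, 0 <= tnth v i <= 1) -> F v = G v) ->
  iter_integral01 F = iter_integral01 G.
Proof.
elim: k F G => [|k IH] F G FG; first by apply: FG => -[].
rewrite !int01_iter; apply: eq_int01 => x x01; apply: IH => v v01.
apply: FG => i.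
by case: (unliftP ord0 i) => [j ->|->]; rewrite ?tnthS ?tnth0.
Qed.

Definition grid_tuple (R : realType) (n k : nat) (t : k.-tuple 'I_n) : k.-tuple R :=
  [tuple of [seq (val i)%:R / n%:R | i <- t]].

(** One variable is discretized at a time, each at cost [e]: [riemann01] for the outer one,
    induction at every grid value for the others. *)
Lemma iter_integral_riemann (R : realType) (k n : nat) (F : k.-tuple R -> R) (e : R) :
  bdd_ucontn F -> (0 < n)%N ->
  (forall u v, (forall i, `|tnth u i - tnth v i| <= n%:R^-1) -> `|F u - F v| <= e) ->
  `|iter_integral01 F - n%:R^-1 ^+ k * \sum_(t : k.-tuple 'I_n) F (grid_tuple R t)|
    <= k%:R * e.
Proof.
move=> cF n0; elim: k F cF => [|k IH] F cF Fe.
  rewrite expr0 mul1r mul0r (big_pred1 [tuple]) => [|t]; last by rewrite [t]tuple0 /= eqxx.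
  by rewrite (_ : grid_tuple R [tuple] = [tuple]) ?subrr ?normr0 //; exact: tuple0.
have nn0 : n%:R != 0 :> R by rewrite pnatr_eq0 -lt0n.
set g := fun x => iter_integral01 (fun v : k.-tuple R => F [tuple of x :: v]).
have [[C FC] uF] := cF.
have gprop x := iter_integral_props (bdd_ucontn_cons x cF).
have mg : measurable_fun setT g.
  apply: ucont1_measurable => r r0; have [d d0 Fd] := uF r r0.
  exists d => // x y xy; apply: (gprop x).2; first exact: bdd_ucontn_cons.
  move=> v; apply: Fd => i.
  case: (unliftP ord0 i) => [j ->|->]; last by rewrite !tnth0.
  by rewrite !tnthS subrr normr0.
have h1 : `|int01 g - n%:R^-1 * \sum_(j < n) g (j%:R / n%:R)| <= e.
  apply: riemann01 mg (fun x => (gprop x).1 C (fun v => FC _)) n0 _ => x y xy.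
  apply: (gprop x).2; first exact: bdd_ucontn_cons.
  move=> v; apply: Fe => i.
  case: (unliftP ord0 i) => [j ->|->]; last by rewrite !tnth0.
  by rewrite !tnthS subrr normr0 invr_ge0.
pose s (j : 'I_n) := n%:R^-1 ^+ k *
  \sum_(t : k.-tuple 'I_n) F [tuple of j%:R / n%:R :: grid_tuple R t].
have h2 (j : 'I_n) : `|g (j%:R / n%:R) - s j| <= k%:R * e.
  apply: IH; first exact: bdd_ucontn_cons.
  move=> u v uv; apply: Fe => i.
  case: (unliftP ord0 i) => [l ->|->]; first by rewrite !tnthS.
  by rewrite !tnth0 subrr normr0 invr_ge0.
have -> : n%:R^-1 ^+ k.+1 * \sum_(t : k.+1.-tuple 'I_n) F (grid_tuple R t)
    = n%:R^-1 * \sum_(j < n) s j.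
  rewrite exprS -mulrA; congr (_ * _); rewrite /s -big_distrr /=; congr (_ * _).
  rewrite pair_big /=.
  rewrite (reindex (fun p : 'I_n * k.-tuple 'I_n => [tuple of p.1 :: p.2])) /=.
    by apply: eq_bigr => p _; congr F; exact: val_inj.
  exists (fun t : k.+1.-tuple 'I_n => (thead t, [tuple of behead t])).
    by move=> [j t] _; rewrite theadE; congr pair; exact: val_inj.
  by move=> t _; rewrite [RHS]tuple_eta.
rewrite int01_iter -/g -(subrKA (n%:R^-1 * \sum_(j < n) g (j%:R / n%:R))).
rewrite -natr1 mulrDl mul1r addrC (le_trans (ler_normD _ _)) // lerD //.
rewrite -mulrBr -sumrB normrM gtr0_norm ?invr_gt0 ?ltr0n //.
rewrite ler_pdivrMl ?ltr0n // (le_trans (ler_norm_sum _ _ _)) //.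
have -> : n%:R * (k%:R * e) = \sum_(j < n) (k%:R * e) by rewrite sumr_const card_ord [LHS]mulr_natl.
by apply: ler_sum => j _; exact: h2.
Qed.

(** * Domination and passage to the limit *)

(** [k^k / k!] is a single term of the exponential series at [k]. *)
Lemma pow_self_le_fact (R : realType) (k : nat) :
  (k%:R ^+ k : R) <= expR 1 ^+ k * k`!%:R.
Proof.
case: k => [|k]; first by rewrite !expr0 mul1r.
rewrite -ler_pdivrMr ?ltr0n ?fact_gt0 // -expRM_natl mulr1.
by apply: le_trans (expR_ge1Dxn k _); rewrite ?lerDr.
Qed.

(* From Hadamard's bound and the AM-GM inequality applied to [2^-k] and
   [2^k |det M| / k!]. *)
Definition det_majorant (R : realType) (B : R) (k : nat) : R :=
  2^-1 * 4^-1 ^+ k + 2^-1 * exp_coeff (4 * B ^+ 2 * expR 1) k.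

Lemma is_cvg_det_majorant (R : realType) (B : R) :
  cvgn (series (det_majorant B)).
Proof.
have -> : det_majorant B
    = geometric 2^-1 4^-1 + 2^-1 *: exp_coeff (4 * B ^+ 2 * expR 1).
  by apply/funext => k.
apply: is_cvg_seriesD; last by apply: is_cvg_seriesZ; exact: is_cvg_series_exp_coeff.
by apply: is_cvg_geometric_series; rewrite ger0_norm // invf_lt1 // ltr1n.
Qed.

Lemma det_majorantP (R : realType) (B : R) (k : nat) (M : 'M[R]_k) :
  (forall i j, `|M i j| <= B) -> k`!%:R^-1 * `|\det M| <= det_majorant B k.
Proof.
move=> MB; have D2 := hadamard_bound MB.
have f0 : 0 < k`!%:R :> R by rewrite ltr0n fact_gt0.
rewrite /det_majorant /exp_coeff /=.
set p := 2^-1 ^+ k : R; set q : R := 2 ^+ k * (k`!%:R^-1 * `|\det M|).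
have -> : k`!%:R^-1 * `|\det M| = p * q.
  by rewrite /q /p [RHS]mulrA -exprMn mulVf ?pnatr_eq0 // expr1n mul1r.
have hp : p ^+ 2 = 4^-1 ^+ k.
  by rewrite /p exprAC; congr (_ ^+ _); field.
(* Hadamard's bound leaves [k^k] over the square of [k!]; [pow_self_le_fact] trades [k^k] for one
   factorial, leaving a term of an exponential series. *)
have hq : q ^+ 2 <= (4 * B ^+ 2 * expR 1) ^+ k / k`!%:R.
  rewrite /q !exprMn real_normK ?num_real // exprAC (_ : 2 ^+ 2 = 4); last by ring.
  rewrite exprVn.
  apply: (@le_trans _ _ (4 ^+ k * ((k`!%:R ^+ 2)^-1 * (k%:R * B ^+ 2) ^+ k))).
    by rewrite ler_wpM2l ?exprn_ge0 // ler_wpM2l // invr_ge0 exprn_ge0 // ltW.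
  rewrite !exprMn; set b := B ^+ k * B ^+ k.
  have b0 : 0 <= b by rewrite /b -expr2 sqr_ge0.
  have h := ler_wpM2l (_ : 0 <= 4 ^+ k * b / k`!%:R ^+ 2) (pow_self_le_fact R k).
  have {}h := h (divr_ge0 (mulr_ge0 (exprn_ge0 _ (ler0n _ _)) b0) (exprn_ge0 _ (ltW f0))).
  apply: le_trans (_ : 4 ^+ k * b / k`!%:R ^+ 2 * k%:R ^+ k <= _).
    by rewrite le_eqVlt; apply/orP; left; apply/eqP; ring.
  apply: (le_trans h); rewrite le_eqVlt; apply/orP; left; apply/eqP.
  move: f0; set x := 4 ^+ k; set y := expR 1 ^+ k; set z := k`!%:R.
  by move=> z0; field; rewrite gt_eqF.
rewrite -hp -mulrDr ler_pdivlMl //.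
have := sqr_ge0 (p - q); move: hq; rewrite sqrrB.
set z := _ / _; move=> hz hs; have := mulr2n (p * q); lra.
Qed.

Lemma minor_sumZ (R : realType) (n k : nat) (M : 'M[R]_n) :
  minor_sum (n%:R^-1 *: M) k = k`!%:R^-1 * (n%:R^-1 ^+ k *
    \sum_(t : k.-tuple 'I_n) \det (\matrix_(p < k, q < k) M (tnth t p) (tnth t q))).
Proof.
rewrite /minor_sum; congr (_ * _); rewrite big_distrr /=; apply: eq_bigr => t _.
by rewrite -detZ; congr (\det _); apply/matrixP => p q; rewrite !mxE.
Qed.

Lemma tuple_average_le (R : realType) (n k : nat) (f : k.-tuple 'I_n -> R) (c : R) :
  (0 < n)%N -> (forall t, `|f t| <= c) ->
  `|n%:R^-1 ^+ k * \sum_(t : k.-tuple 'I_n) f t| <= c.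
Proof.
move=> n0 fc; rewrite normrM ger0_norm ?exprn_ge0 ?invr_ge0 //.
rewrite exprVn ler_pdivrMl ?exprn_gt0 ?ltr0n //.
apply: (le_trans (ler_norm_sum _ _ _)).
have -> : n%:R ^+ k * c = \sum_(t : k.-tuple 'I_n) c.
  by rewrite sumr_const card_tuple card_ord -natrX [LHS]mulr_natl.
exact: ler_sum.
Qed.

Lemma minor_sum_bound (R : realType) (n k : nat) (M : 'M[R]_n) (B : R) :
  (0 < n)%N -> (forall i j, `|M i j| <= B) ->
  `|minor_sum (n%:R^-1 *: M) k| <= det_majorant B k.
Proof.
move=> n0 MB; rewrite minor_sumZ mulrCA big_distrr /=.
apply: tuple_average_le => // t; rewrite normrM ger0_norm ?invr_ge0 //.
by apply: det_majorantP => p q; rewrite mxE.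
Qed.

Lemma minor_sum_cvg (R : realType) (K : R -> R -> R) (M : forall n, 'M[R]_n) (k : nat) :
  bdd_ucont2 K ->
  (forall e : R, 0 < e -> exists N : nat, forall n, (N <= n)%N -> forall i j : 'I_n,
     `|M n i j - K (i%:R / n%:R) (j%:R / n%:R)| <= e) ->
  minor_sum (n%:R^-1 *: M n) k @[n --> \oo] --> fredholm_term K k.
Proof.
move=> cK HM; have [[B0 KB0] _] := cK.
(* The extra unit makes [B] bound the entries of [M n] as well, since they lie within [d1 <= 1] of
   values of [K]. *)
pose B := Num.max 1 B0 + 1.
have B1 : 1 <= B by rewrite /B lerDr le_max ler01.
have KB x y : `|K x y| <= B - 1 by rewrite /B addrK le_max KB0 orbT.
have KB' x y : `|K x y| <= B by apply: le_trans (KB x y) _; rewrite gerBl.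
apply/cvgrPdist_le => e e0.
set c : R := k`!%:R * (k%:R * B ^+ k).
have c0 : 0 <= c by rewrite !mulr_ge0 // exprn_ge0 // (le_trans _ B1).
pose d1 := Num.min 1 (e / (2 * (c + 1))).
have d10 : 0 < d1 by rewrite lt_min ltr01 divr_gt0 // mulr_gt0 // ltr_wpDl.
have [N1 H1] := HM d1 d10.
have cF := bdd_ucontn_det k cK.
have [_ uF] := cF.
have e2 : 0 < e / (2 * (k%:R + 1)) by rewrite divr_gt0 // mulr_gt0 // ltr_wpDl.
have [d2 d20 H2] := uF _ e2.
have [N2 H3] := inv_nat_small d20.
exists (maxn N1 N2) => // n /=; rewrite geq_max => /andP[n1 /H3[n0 nd]].
have MK := H1 n n1.
rewrite minor_sumZ /fredholm_term -mulrBr normrM ger0_norm ?invr_ge0 //.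
have f1 : 1 <= k`!%:R :> R by rewrite ler1n fact_gt0.
rewrite ler_pdivrMl ?(lt_le_trans _ f1) //.
apply: (@le_trans _ _ e); last by rewrite ler_peMl // ltW.
set F := (fun _ : k.-tuple R => _) in cF uF H2 *.
have h1 : `|iter_integral01 F - n%:R^-1 ^+ k *
    \sum_(t : k.-tuple 'I_n) F (grid_tuple R t)| <= k%:R * (e / (2 * (k%:R + 1))).
  apply: iter_integral_riemann => // u v uv; apply: H2 => i.
  exact: le_lt_trans nd.
have h2 : `|n%:R^-1 ^+ k * (\sum_(t : k.-tuple 'I_n) F (grid_tuple R t)) -
    n%:R^-1 ^+ k * \sum_(t : k.-tuple 'I_n)
      \det (\matrix_(p < k, q < k) M n (tnth t p) (tnth t q))| <= c * d1.
  rewrite -mulrBr -sumrB; apply: tuple_average_le => // t.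
  rewrite /c -mulrA; apply: det_lip => // i j; rewrite !mxE.
  - exact: KB'.
  - rewrite -[M _ _ _](subrK (K ((tnth t i)%:R / n%:R) ((tnth t j)%:R / n%:R))).
    rewrite (le_trans (ler_normD _ _)) // -[leRHS](subrK 1) [leRHS]addrC lerD //.
    by apply: (le_trans (MK _ _)); rewrite ge_min lexx.
  - by rewrite distrC !tnth_map; exact: MK.
rewrite -(subrKA (n%:R^-1 ^+ k * \sum_(t : k.-tuple 'I_n) F (grid_tuple R t))).
apply: (le_trans (ler_normD _ _)); rewrite [leRHS]splitr; apply: lerD.
  apply: (le_trans h1).
  have -> : k%:R * (e / (2 * (k%:R + 1))) = k%:R / (k%:R + 1) * (e / 2) :> R.
    by field; rewrite gt_eqF // ltr_wpDl.
  apply: ler_piMl; first by rewrite divr_ge0 // ltW.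
  by rewrite ler_pdivrMr ?mul1r ?lerDl // ltr_wpDl.
apply: (le_trans h2); apply: (@le_trans _ _ (c * (e / (2 * (c + 1))))).
  by rewrite ler_wpM2l // ge_min lexx orbT.
have c10 : 0 < c + 1 by rewrite ltr_wpDl.
have -> : c * (e / (2 * (c + 1))) = c / (c + 1) * (e / 2).
  by field; rewrite gt_eqF.
apply: ler_piMl; first by rewrite divr_ge0 // ltW.
by rewrite ler_pdivrMr ?mul1r ?lerDl.
Qed.

(** Dominated convergence for sums whose length grows with [n]. Beyond [m], the terms of row [n] are
    controlled by a difference of two partial sums of [b], each within [e / 4] of the limit; the
    first [m] terms converge one by one. *)
Lemma tannery (R : realType) (a : nat -> nat -> R) (b c : nat -> R) (l : R) :
  (forall k, a n k @[n --> \oo] --> c k) ->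
  (\forall n \near \oo, forall k, `|a n k| <= b k) ->
  cvgn (series b) ->
  \sum_(k < n.+1) a n k @[n --> \oo] --> l ->
  series c @ \oo --> l.
Proof.
move=> ac ab cb al; apply/cvgrPdist_le => e e0.
have e4 : 0 < e / 4 by rewrite divr_gt0.
have /cvgrPdist_le/(_ _ e4)[m0 _ Hm0] := cb.
exists m0 => // m /= mm0.
have sac : \sum_(k < m) a n k @[n --> \oo] --> \sum_(k < m) c k.
  by apply: cvg_big => //; exact: add_continuous.
have /cvgrPdist_le/(_ _ e4) H1 := sac.
have /cvgrPdist_le/(_ _ e4) H2 := al.
near \oo => n.
have h1 : `|\sum_(k < m) c k - \sum_(k < m) a n k| <= e / 4 by near: n.
have h2 : `|l - \sum_(k < n.+1) a n k| <= e / 4 by near: n.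
have h3 : forall k, `|a n k| <= b k by near: n.
have mn : (m <= n)%N by near: n; exact: nbhs_infty_ge.
have h4 : `|\sum_(k < n.+1) a n k - \sum_(k < m) a n k| <= e / 2.
  rewrite -!(big_mkord xpredT) (big_cat_nat (leq0n m) (leqW mn)) /= addrAC subrr add0r.
  apply: (le_trans (ler_norm_sum _ _ _)).
  apply: (@le_trans _ _ (series b n.+1 - series b m)).
    by rewrite sub_series leqW //; apply: ler_sum.
  have := Hm0 _ mm0; have := Hm0 _ (leq_trans mm0 (leqW mn)).
  rewrite !ler_norml => /andP[? ?] /andP[? ?]; lra.
rewrite seriesEord /=; move: h1 h2 h4; rewrite !ler_norml.
move=> /andP[? ?] /andP[? ?] /andP[? ?]; apply/andP; split; lra.
Unshelve. all: end_near. Qed.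

(** The inequality [1 + z <= expR z] at [z = - x / (1 + x)], inverted, gives
    [expR (x / (1 + x)) <= 1 + x]; and [x / (1 + x)] is at least [x - 2 * x ^+ 2] as soon as
    [1 + 2 * x >= 0]. *)
Lemma expR_le1D (R : realType) (x : R) : `|x| <= 2^-1 ->
  expR (x - 2 * x ^+ 2) <= 1 + x.
Proof.
rewrite ler_norml => /andP[xl xu].
have x1 : 0 < 1 + x by lra.
have h : (1 + x)^-1 <= expR (- (x / (1 + x))).
  apply: le_trans (expR_ge1Dx _); rewrite le_eqVlt; apply/orP; left; apply/eqP.
  by field; rewrite gt_eqF.
apply: (@le_trans _ _ (expR (x / (1 + x)))); last first.
  by rewrite -[leRHS]invrK -lef_pV2 ?invrK ?posrE ?expR_gt0 ?invr_gt0 // -expRN.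
rewrite ler_expR ler_pdivlMr //.
have -> : (x - 2 * x ^+ 2) * (1 + x) = x - x ^+ 2 * (1 + 2 * x) by ring.
by rewrite gerBl mulr_ge0 ?sqr_ge0 //; lra.
Qed.

Lemma cvg_inv_nat (R : realType) : n%:R^-1 @[n --> \oo] --> (0 : R).
Proof.
apply/cvgrPdist_le => e e0; have [N HN] := inv_nat_small e0.
by exists N => // n /= /HN[_ ne]; rewrite sub0r normrN ger0_norm ?invr_ge0 // ltW.
Qed.

Lemma chol_det_cvg (R : realType) (tau : R -> R -> R) : bdd_ucont2 tau ->
  \det (chol tau n) ^+ 2 @[n --> \oo] --> expR (int01 (fun t => tau t t)).
Proof.
move=> [[B tB] ut]; have B0 : 0 <= B by apply: le_trans (tB 0 0).
set I := int01 _.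
pose S (n : nat) : R := n%:R^-1 * \sum_(j < n) tau (j%:R / n%:R) (j%:R / n%:R).
have ud : ucont1 (fun t => tau t t).
  by move=> e /ut[d d0 td]; exists d => // x y xy; exact: td.
have SI : S n @[n --> \oo] --> I.
  apply/cvgrPdist_le => e e0; have [d d0 td] := ud e e0.
  have [N HN] := inv_nat_small d0.
  exists N => // n /= /HN[n0 nd].
  apply: riemann01 (ucont1_measurable ud) (fun x => tB x x) n0 _ => x y xy.
  by apply: td; exact: le_lt_trans nd.
have LI : S n - B ^+ 2 * n%:R^-1 @[n --> \oo] --> I.
  rewrite -[X in _ --> X]subr0 -[X in _ - X](mulr0 (B ^+ 2)).
  by apply: cvgB => //; apply: cvgMr; exact: cvg_inv_nat.
have eS : expR (S n) @[n --> \oo] --> expR I.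
  exact: (continuous_cvg _ (@continuous_expR R I) SI).
have eL : expR (S n - B ^+ 2 * n%:R^-1) @[n --> \oo] --> expR I.
  exact: (continuous_cvg _ (@continuous_expR R I) LI).
(* The upper bound is [1 + x <= expR x] in each factor. In the lower one, [n] losses [2 * x ^+ 2] of
   size at most [B ^+ 2 / (2 n^2)] add up to [B ^+ 2 / (2 n)], doubled by the final squaring. *)
apply: squeeze_cvgr eL eS.
have B1 : 0 < (B + 1)^-1 by rewrite invr_gt0 ltr_wpDl.
have [N HN] := inv_nat_small B1.
exists N => // n /= /HN[n0 nB].
have np : 0 < n%:R :> R by rewrite ltr0n.
have nn0 : n%:R != 0 :> R by rewrite gt_eqF.
rewrite det_chol.
pose x (i : 'I_n) : R := tau (i%:R / n%:R) (i%:R / n%:R) / (2 * n%:R).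
have xB i : `|x i| <= B / (2 * n%:R).
  rewrite /x normrM normfV (ger0_norm (_ : 0 <= 2 * n%:R)) ?mulr_ge0 //.
  by rewrite ler_pM2r ?invr_gt0 ?mulr_gt0.
have x2 i : `|x i| <= 2^-1.
  apply: (le_trans (xB i)); rewrite ler_pdivrMr ?mulr_gt0 // mulrA mulVf // mul1r.
  rewrite ltf_pV2 ?posrE ?ltr_wpDl // in nB; lra.
have xx i : x i - B ^+ 2 / (2 * n%:R ^+ 2) <= x i - 2 * x i ^+ 2.
  rewrite lerD2l lerN2.
  have -> : B ^+ 2 / (2 * n%:R ^+ 2) = 2 * (B / (2 * n%:R)) ^+ 2 by field.
  rewrite ler_wpM2l // -[x i ^+ 2]real_normK ?num_real //.
  by rewrite lerXn2r ?nnegrE // (le_trans _ (xB i)).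
have SE : \sum_i x i = S n / 2.
  rewrite /S mulrAC big_distrr /=; apply: eq_bigr => i _.
  by rewrite /x; field.
have lo : expR (S n / 2 - B ^+ 2 / (2 * n%:R)) <= \prod_i (1 + x i).
  have -> : S n / 2 - B ^+ 2 / (2 * n%:R)
      = \sum_(i < n) (x i - B ^+ 2 / (2 * n%:R ^+ 2)).
    rewrite sumrB SE; congr (_ - _).
    by rewrite sumr_const card_ord -[RHS]mulr_natl; field.
  rewrite expR_sum; apply: ler_prod => i _; rewrite expR_ge0 /=.
  by apply: le_trans (expR_le1D (x2 i)); rewrite ler_expR.
have up : \prod_i (1 + x i) <= expR (S n / 2).
  rewrite -SE expR_sum; apply: ler_prod => i _; rewrite expR_ge1Dx andbT.
  by have := x2 i; rewrite ler_norml => /andP[? ?]; lra.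
have sq (z : R) : expR (2 * z) = expR z ^+ 2 by rewrite expRM_natl.
rewrite (_ : S n - _ = 2 * (S n / 2 - B ^+ 2 / (2 * n%:R))); last by field.
rewrite (_ : expR (S n) = expR (S n / 2) ^+ 2); last by rewrite -sq mulrC divfK.
have p0 : 0 <= \prod_i (1 + x i) by apply: le_trans lo; exact: expR_ge0.
by rewrite sq; apply/andP; split; rewrite lerXn2r ?nnegrE ?expR_ge0.
Qed.

Theorem theorem1 (R : realType)
  (kA : R -> R -> R) (A : L2 R -> L2 R)
  (kT : R -> R -> R) (T Tadj : L2 R -> L2 R)
  (hkA : continuous_on_square kA)
  (hA : integral_operator kA A)
  (hkT : continuous_on_lower_triangle kT)
  (hkT0 : triangular_kernel kT)
  (hT : integral_operator kT T)
  (hTadj : is_adjoint T Tadj)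
  (hdec : L2_op_eq (id_plus A) (id_plus T \o id_plus Tadj)) :
  [/\ cvgn (series (fredholm_term kA)),
      0 < fredholm_det kA
    & ln (fredholm_det kA)
      = \int[lebesgue_measure]_(t in `[0, 1]) kT t t].
Proof.
have [KA cKA eKA] := square_extension hkA.
have [tau [ctau _ etau]] := triangle_extension hkT.
have lf := lf_intro hA hkT0 hT hTadj hdec ctau eKA etau.
have approx := chol_approx ctau (kernel_identity ctau cKA lf).
have termE : fredholm_term kA = fredholm_term KA.
  apply/funext => k; congr (_ * _); apply: eq_iter_integral => v v01.
  by congr (\det _); apply/matrixP => p q; rewrite !mxE eKA.
have main : series (fredholm_term kA) @ \oo --> expR (int01 (fun t => tau t t)).
  have [[B KB] _] := cKA.
  rewrite termE; apply: (tannery (b := det_majorant (B + 1))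
    (a := fun n k => minor_sum (n%:R^-1 *: chol_defect tau n) k)).
  - by move=> k; exact: minor_sum_cvg.
  (* Tolerance 1 suffices here: for large [n] all entries of [chol_defect] are at most [B + 1], so
     one majorant serves for all these [n]. *)
  - have [N HN] := approx 1 ltr01.
    exists (maxn N 1) => // n /=; rewrite geq_max => /andP[Nn n0] k.
    apply: minor_sum_bound => // i j.
    rewrite -[chol_defect _ _ _ _](subrK (KA (i%:R / n%:R) (j%:R / n%:R))).
    by rewrite (le_trans (ler_normD _ _)) // addrC lerD // HN.
  - exact: is_cvg_det_majorant.
  - apply: cvg_trans (chol_det_cvg ctau); apply: near_eq_cvg.
    exists 1%N => // n /= n0.
    by rewrite -chol_defect_det // (det_add1_minor_sum _ (ltnSn n)).
have detE : fredholm_det kA = expR (int01 (fun t => tau t t)) by exact: cvg_lim.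
split.
- by apply/cvg_ex; eexists; exact: main.
- by rewrite detE expR_gt0.
- rewrite detE expRK; apply: eq_int01 => t /andP[t0 t1].
  by rewrite etau.
Qed.
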